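(* Let $X$ be a geodesic metric space of finite affine rank. Assume that $X$ is decomposed as a direct product in two different ways, $Y\times\bar Y=X=Z\times\bar Z$, and that the decompositions are transversal at some point $x\in X$, i.e. the fibers through $x$ satisfy $$Y_x\cap Z_x=Y_x\cap\bar Z_x=\bar Y_x\cap Z_x=\bar Y_x\cap\bar Z_x=\{x\}.$$ Then $X$ is isometric to a Euclidean space $\mathbb{R}^{2m}$ for some integer $m\ge 0$.
   Context: Direct product: for metric spaces $Y,\bar Y$, $Y\times\bar Y$ is the Cartesian product with metric $d((y,\bar y),(y',\bar y'))=\sqrt{d^2(y,y')+d^2(\bar y,\bar y')}$. An equality $X=Y\times\bar Y$ means that a (surjective) isometry $I:X\to Y\times\bar Y$ is fixed; it defines projections $P^Y:X\to Y$ and $P^{\bar Y}:X\to\bar Y$. For $x\in X$ the $Y$-fiber through $x$ is $Y_x=(P^{\bar Y})^{-1}(P^{\bar Y}(x))$ and the $\bar Y$-fiber through $x$ is $\bar Y_x=(P^{Y})^{-1}(P^{Y}(x))$; similarly for $Z,\bar Z$. A geodesic is an isometric embedding of an interval; a metric space is geodesic if each pair of its points is connected by a geodesic. A metric space is affine if it is isometric to a linearly convex subset of a real normed vector space. The affine rank of $X$ is the supremum of the topological dimensions of affine metric spaces that admit an isometric embedding into $X$. *)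

(* Defs.v *)
From HB Require Import structures.
From mathcomp Require Import all_boot all_order all_algebra.
From mathcomp Require Import all_classical all_reals all_analysis.
From mathcomp Require Import ring lra.
Import Order.TTheory GRing.Theory Num.Theory.
Import numFieldNormedType.Exports.

Set Implicit Arguments.
Unset Strict Implicit.
Unset Printing Implicit Defensive.

Local Open Scope classical_set_scope.
Local Open Scope card_scope.
Local Open Scope ring_scope.

Section isometries.
Context {R : realType} {X Y : metricType R}.

Definition isometric_embedding (f : X -> Y) :=
  forall x x', mdist (f x) (f x') = mdist x x'.

Definition is_isometry (f : X -> Y) :=
  isometric_embedding f /\ range f = [set: Y].

End isometries.

Definition isometric {R : realType} (X Y : metricType R) :=
  exists f : X -> Y, is_isometry f.

Section minkowski.
Context {R : realType} {I : finType}.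
Implicit Types a b : I -> R.

Lemma sum_sqr_ge0 a : 0 <= \sum_i a i ^+ 2.
Proof. by apply: sumr_ge0 => i _; exact: sqr_ge0. Qed.

Lemma sum_cauchy_schwarz a b :
  (\sum_i a i * b i) ^+ 2 <= (\sum_i a i ^+ 2) * (\sum_i b i ^+ 2).
Proof.
set A := \sum_i a i ^+ 2; set B := \sum_i b i ^+ 2; set C := \sum_i a i * b i.
have B0 : 0 <= B by exact: sum_sqr_ge0.
have [Bz|Bn0] := eqVneq B 0.
  have bz i : b i = 0.
    apply/eqP; rewrite -sqrf_eq0.
    have := Bz => /eqP; rewrite psumr_eq0; last by move=> j _; exact: sqr_ge0.
    by move=> /allP /(_ i (mem_index_enum i)).
  by rewrite Bz mulr0 /C big1 ?expr0n// => i _; rewrite bz mulr0.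
have Bp : 0 < B by rewrite lt_def Bn0.
have : 0 <= \sum_i (B * a i - C * b i) ^+ 2 by exact: sum_sqr_ge0.
have -> : \sum_i (B * a i - C * b i) ^+ 2 = B * (A * B - C ^+ 2).
  have H be ga : \sum_i (be * a i - ga * b i) ^+ 2 =
      be ^+ 2 * A - 2 * be * ga * C + ga ^+ 2 * B.
    rewrite /A /C /B !mulr_sumr -sumrB -big_split/=.
    by apply: eq_bigr => i _; ring.
  by rewrite H; ring.
by rewrite pmulr_rge0// subr_ge0.
Qed.

Lemma sum_minkowski a b :
  Num.sqrt (\sum_i (a i + b i) ^+ 2) <=
  Num.sqrt (\sum_i a i ^+ 2) + Num.sqrt (\sum_i b i ^+ 2).
Proof.
have [A0 B0] := (sum_sqr_ge0 a, sum_sqr_ge0 b).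
rewrite -(ler_pXn2r (n := 2))// ?nnegrE ?addr_ge0 ?sqrtr_ge0//.
rewrite sqr_sqrtr ?sum_sqr_ge0// sqrrD !sqr_sqrtr//.
have -> : \sum_i (a i + b i) ^+ 2 =
    \sum_i a i ^+ 2 + (\sum_i a i * b i) *+ 2 + \sum_i b i ^+ 2.
  by rewrite -sumrMnl -!big_split/=; apply: eq_bigr => i _; rewrite sqrrD.
rewrite lerD2r lerD2l lerMn2r/= -sqrtrM// (le_trans (ler_norm _))//.
by rewrite -sqrtr_sqr ler_wsqrtr// sum_cauchy_schwarz.
Qed.

End minkowski.

(* An alias of [Y * Y'], because the library metrizes products by the maximum
   of the two distances. *)
Definition l2prod (Y Y' : Type) : Type := (Y * Y')%type.

HB.instance Definition _ (Y Y' : choiceType) :=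
  Choice.copy (l2prod Y Y') (Y * Y')%type.

Section l2prod_metric.
Context {R : realType} {Y Y' : metricType R}.
Implicit Types p q r : l2prod Y Y'.

Definition l2prod_dist p q : R :=
  Num.sqrt (mdist p.1 q.1 ^+ 2 + mdist p.2 q.2 ^+ 2).

Let l2prod_distxx p : l2prod_dist p p = 0.
Proof. by rewrite /l2prod_dist !mdistxx expr0n addr0 sqrtr0. Qed.

Let l2prod_dist_positivity p q : l2prod_dist p q = 0 -> p = q.
Proof.
move/eqP; rewrite sqrtr_eq0 => d0.
have : mdist p.1 q.1 ^+ 2 + mdist p.2 q.2 ^+ 2 == 0.
  by rewrite eq_le d0 addr_ge0// sqr_ge0.
rewrite paddr_eq0 ?sqr_ge0// !sqrf_eq0 => /andP[/eqP p1 /eqP p2].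
by case: p q p1 p2 {d0} => [? ?] [? ?]/= /mdist_positivity -> /mdist_positivity ->.
Qed.

Let l2prod_dist_sym p q : l2prod_dist p q = l2prod_dist q p.
Proof. by rewrite /l2prod_dist metric_sym (metric_sym p.2). Qed.

Let l2prod_dist_triangle q p r :
  l2prod_dist p r <= l2prod_dist p q + l2prod_dist q r.
Proof.
pose a b := if b then mdist p.1 q.1 else mdist p.2 q.2.
pose c b := if b then mdist q.1 r.1 else mdist q.2 r.2.
have := @sum_minkowski R bool a c; rewrite !big_bool/=; apply: le_trans.
by apply: ler_wsqrtr; apply: lerD; apply: lerXn2r;
  rewrite ?nnegrE ?addr_ge0 ?mdist_ge0// metric_triangle.
Qed.

HB.instance Definition _ := @isMetric.Build R (l2prod Y Y') l2prod_dist
  l2prod_distxx l2prod_dist_positivity l2prod_dist_sym l2prod_dist_triangle.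

Lemma mdist_l2prodE p q :
  mdist p q = Num.sqrt (mdist p.1 q.1 ^+ 2 + mdist p.2 q.2 ^+ 2).
Proof. by []. Qed.

End l2prod_metric.

(* An alias of row vectors, because the library gives them the sup norm. *)
Definition euclidean (R : realType) (n : nat) : Type := 'rV[R]_n.

HB.instance Definition _ (R : realType) (n : nat) :=
  Choice.copy (euclidean R n) 'rV[R]_n.

Section euclidean_metric.
Context {R : realType} {n : nat}.
Implicit Types u v w : 'rV[R]_n.

Definition euclidean_dist u v : R :=
  Num.sqrt (\sum_(i < n) (u 0 i - v 0 i) ^+ 2).

Let euclidean_distxx u : euclidean_dist u u = 0.
Proof.
by rewrite /euclidean_dist big1 ?sqrtr0// => i _; rewrite subrr expr0n.
Qed.

Let euclidean_dist_positivity u v : euclidean_dist u v = 0 -> u = v.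
Proof.
move/eqP; rewrite sqrtr_eq0 => d0.
have : \sum_(i < n) (u 0 i - v 0 i) ^+ 2 == 0.
  by rewrite eq_le d0 sum_sqr_ge0.
rewrite psumr_eq0; last by move=> i _; exact: sqr_ge0.
move=> /allP uv; apply/rowP => i.
have := uv i (mem_index_enum i).
by rewrite /= sqrf_eq0 subr_eq0 => /eqP.
Qed.

Let euclidean_dist_sym u v : euclidean_dist u v = euclidean_dist v u.
Proof.
by congr Num.sqrt; apply: eq_bigr => i _; rewrite -sqrrN opprB.
Qed.

Let euclidean_dist_triangle v u w :
  euclidean_dist u w <= euclidean_dist u v + euclidean_dist v w.
Proof.
apply: le_trans (sum_minkowski _ _).
by rewrite le_eqVlt; apply/orP; left; apply/eqP; congr Num.sqrt;
  apply: eq_bigr => i _; rewrite subrKA.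
Qed.

HB.instance Definition _ := @isMetric.Build R (euclidean R n) euclidean_dist
  euclidean_distxx euclidean_dist_positivity euclidean_dist_sym
  euclidean_dist_triangle.

Lemma mdist_euclideanE (u v : euclidean R n) :
  mdist u v = Num.sqrt (\sum_(i < n) ((u : 'rV_n) 0 i - (v : 'rV_n) 0 i) ^+ 2).
Proof. by []. Qed.

End euclidean_metric.

Section decompositions.
Context {R : realType} {X : metricType R}.

Section fibers.
Context {Y Y' : metricType R}.
Implicit Type I : X -> l2prod Y Y'.

Definition fst_proj I (x : X) : Y := (I x).1.

Definition snd_proj I (x : X) : Y' := (I x).2.

(* The fiber in the direction of the first factor: the second projection is
   constant on it. *)
Definition fiber1 I (x : X) : set X := snd_proj I @^-1` [set snd_proj I x].

Definition fiber2 I (x : X) : set X := fst_proj I @^-1` [set fst_proj I x].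

End fibers.

Definition transversal_at {Y Y' Z Z' : metricType R}
    (I : X -> l2prod Y Y') (J : X -> l2prod Z Z') (x : X) :=
  [/\ fiber1 I x `&` fiber1 J x = [set x],
      fiber1 I x `&` fiber2 J x = [set x],
      fiber2 I x `&` fiber1 J x = [set x] &
      fiber2 I x `&` fiber2 J x = [set x]].

End decompositions.

Definition geodesic {R : realType} {X : metricType R} (a b : R) (g : R -> X) :=
  {in `[a, b] &, forall s t, mdist (g s) (g t) = `|s - t|}.

Definition geodesic_space {R : realType} (X : metricType R) :=
  forall x y : X, exists (a b : R) (g : R -> X),
    [/\ a <= b, geodesic a b g, g a = x & g b = y].

Section covering_dimension.
Context {T : topologicalType}.
Implicit Types U V : set (set T).

Definition open_cover U := U `<=` open /\ \bigcup_(A in U) A = [set: T].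

Definition refines V U := forall A, V A -> exists2 B, U B & A `<=` B.

Definition multiplicity_le U (k : nat) :=
  forall x, [set A | U A /\ A x] #<= `I_k.

Definition covers_refinable (k : nat) :=
  forall U, open_cover U ->
    exists V, [/\ open_cover V, refines V U & multiplicity_le V k].

End covering_dimension.

(* The Lebesgue covering dimension, which is -1 for the empty space and +oo when
   no multiplicity works for all open covers. *)
Definition topological_dim (R : realType) (T : topologicalType) : \bar R :=
  ereal_inf [set (k%:R - 1)%:E | k in [set k | @covers_refinable T k]].

Definition affine {R : realType} (A : metricType R) :=
  exists (V : normedModType R) (f : A -> V),
    (forall x y, `|f x - f y| = mdist x y) /\ @convex_set R V (range f).

Definition affine_rank {R : realType} (X : metricType R) : \bar R :=
  ereal_sup [set d | exists A : metricType R,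
    [/\ affine A, exists f : A -> X, isometric_embedding f &
        d = topological_dim R A]].

(* Main.v *)
(* A straight flat piece [C] of [X] through [x], together with the product of
   its two projections in either decomposition, is again flat: the distance
   between the projections of two points of [C] is a length metric for which
   straight segments are geodesics, and such a metric is translation invariant,
   hence a seminorm. The affine rank bounds the dimension of flats, because the
   covering dimension of an [n]-dimensional cube is at least [n]; so every flat
   extends, without raising the dimension beyond a maximal one, to a flat that is
   the product of its projections for both decompositions.

   Transversality at [x] forces such a flat to be a whole vector space: for
   [u] in [Y] and [w] in the other factor, recombining the coordinates of [u] and
   [u + w] in the second decomposition and projecting to [Y] translates [u] by
   an element depending linearly on [w] only. The squared norm is then additive
   for two transversal splittings, so its second differences are constant; this
   is the parallelogram law. Transversality also gives all factors the same
   dimension [m].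

   Finally two such flats lie in a third one, since each can be recovered from
   either of its projections to the factors of the second decomposition; hence
   one of maximal dimension contains every geodesic issuing from [x]. *)

(* Nothing in the hypotheses makes [X] complete or its geodesics unique or extendible, so a flat is
   at first only a convex piece of a vector space with an arbitrary norm. It is therefore carried as
   a graph in ['rV_n * X], whose domain may be small and whose seminorm may degenerate. That the
   domain is everything and the norm Euclidean are results, both drawn from the map [zigzag]: a
   vector of one factor of the first decomposition passes to the other factor and back, each time
   through a projection of the second. Transversality makes this map injective, finite dimension
   makes it onto, and translations along its values preserve that factor of the domain. The bound on
   the dimension of flats rests on a parity count on a grid, which plays the role of a fixed point
   theorem. Two geodesics from [x] have no common flat to begin with; the rigidity of isometric
   embeddings between Euclidean spaces of equal dimension takes the place of uniqueness of
   geodesics. *)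
From HB Require Import structures.
Require Import Defs.
From mathcomp Require Import all_boot all_order all_algebra.
From mathcomp Require Import all_classical all_reals all_analysis.
From mathcomp Require Import ring lra.
Import Order.TTheory GRing.Theory Num.Theory.
Import numFieldNormedType.Exports.

Set Implicit Arguments.
Unset Strict Implicit.
Unset Printing Implicit Defensive.

Local Open Scope classical_set_scope.
Local Open Scope card_scope.
Local Open Scope ring_scope.

(** * The covering dimension of a cube *)

Section kuhn.
Variables (n p : nat).
Local Notation grid := {ffun 'I_n -> 'I_p.+1}.
Implicit Types (q : grid) (D : {set 'I_n}) (a : grid -> 'F_2) (s : seq (grid -> 'F_2)).

Let addFF (z : 'F_2) : z + z = 0.
Proof. by rewrite -mulr2n -[z *+ 2]mulr_natr pchar_Zp// mulr0. Qed.

Definition grid_up q (j : 'I_n) : grid :=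
  [ffun k => if k == j then inord (q j).+1 else q k].

Lemma grid_upC q j k : j != k ->
  grid_up (grid_up q j) k = grid_up (grid_up q k) j.
Proof.
move=> jk; apply/ffunP => i; rewrite !ffunE (negbTE jk) [k == j]eq_sym (negbTE jk).
by case: (i =P k) => [ik|_]; case: (i =P j) => [ij|_] //; case/eqP: jk; rewrite -ij -ik.
Qed.

(* The cup product of the coboundaries of the labels, summed over the monotone
   paths that leave [q] and use each direction of [D] once. *)
Fixpoint cup s D q : 'F_2 :=
  if s is a :: s' then
    \sum_(j in D) (a (grid_up q j) + a q) * cup s' (D :\ j) (grid_up q j)
  else (D == finset.set0)%:R.

(** Each unordered pair is counted twice, and the values lie in characteristic 2. *)
Lemma sum_sym_pairs D (S : 'I_n -> 'I_n -> 'F_2) :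
  (forall j k, S j k = S k j) -> \sum_(j in D) \sum_(k in D :\ j) S j k = 0.
Proof.
move=> Ssym.
have -> : \sum_(j in D) \sum_(k in D :\ j) S j k =
    \sum_(j in D) \sum_(k in D | (j < k)%N) S j k +
    \sum_(j in D) \sum_(k in D | (k < j)%N) S j k.
  rewrite -big_split/=; apply: eq_bigr => j jD.
  rewrite (bigID (fun k : 'I_n => (j < k)%N))/=; congr (_ + _);
    apply: eq_bigl => k; rewrite !inE -?leqNgt -(inj_eq val_inj)/=;
    case: (ltngtP k j) => //=; by rewrite ?andbT ?andbF.
suff -> : \sum_(j in D) \sum_(k in D | (k < j)%N) S j k =
          \sum_(j in D) \sum_(k in D | (j < k)%N) S j k by exact: addFF.
rewrite (exchange_big_dep (fun k => k \in D))/=; last by move=> j k _ /andP[].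
apply: eq_bigr => j jD; apply: eq_big => [k|k _]; last exact: Ssym.
by rewrite jD.
Qed.

(** This is the cocycle property of a product of coboundaries, on the cube with corner [q] and
    directions [D], as a sum over pairs of opposite faces. After expanding the first factor, the
    terms with [a] at [uu j k] are symmetric in the two directions, those with [a] at [q] become so
    by induction, and the two mixed sums cancel by induction. *)
Lemma cup_closed s D q :
  \sum_(j in D) (cup s (D :\ j) (grid_up q j) + cup s (D :\ j) q) = 0.
Proof.
elim: s D q => [|a s IH] D q /=; first by rewrite big1// => j _; rewrite addFF.
pose W j k := cup s (D :\ j :\ k).
have Wsym j k : W j k = W k j by rewrite /W !finset.setDDl finset.setUC.
pose u j := grid_up q j; pose uu j k := grid_up (u j) k.
have swap (S : 'I_n -> 'I_n -> 'F_2) :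
    \sum_(j in D) \sum_(k in D :\ j) S j k = \sum_(j in D) \sum_(k in D :\ j) S k j.
  rewrite (exchange_big_dep (fun k => k \in D))/=; last by move=> j k _; rewrite !inE => /andP[].
  apply: eq_bigr => j jD; apply: eq_bigl => k; rewrite !inE jD andbT.
  by rewrite eq_sym andbC.
have T1 : \sum_(j in D) \sum_(k in D :\ j) a (uu j k) * W j k (uu j k) = 0.
  rewrite -[RHS](@sum_sym_pairs D
    (fun j k => if j == k then 0 else a (uu j k) * W j k (uu j k))).
    apply: eq_bigr => j _; apply: eq_bigr => k; rewrite !inE eq_sym => /andP[/negbTE -> _].
    by [].
  move=> j k; rewrite eq_sym; case: eqVneq => // kj.
  by rewrite Wsym /uu grid_upC// eq_sym.
have T23 : \sum_(j in D) \sum_(k in D :\ j) (a (u j) * W j k (uu j k)) +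
    \sum_(j in D) \sum_(k in D :\ j) (a (u k) * W j k (u k)) = 0.
  rewrite [X in _ + X]swap -big_split/= big1// => j jD.
  rewrite -big_split/= -[RHS](mulr0 (a (u j))) -[in RHS](IH (D :\ j) (u j)) mulr_sumr.
  by apply: eq_bigr => k _; rewrite mulrDr (Wsym k j).
have T4 : \sum_(j in D) \sum_(k in D :\ j) (a q * W j k (u k)) = 0.
  rewrite (eq_bigr (fun j => a q * \sum_(k in D :\ j) W j k q)).
    by rewrite -mulr_sumr sum_sym_pairs ?mulr0// => j k; rewrite Wsym.
  move=> j jD; rewrite -mulr_sumr; congr (_ * _).
  have := IH (D :\ j) q; rewrite big_split/= => /eqP; rewrite addr_eq0 => /eqP ->.
  by apply/esym/eqP; rewrite -addr_eq0 addFF.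
transitivity (\sum_(j in D) \sum_(k in D :\ j) a (uu j k) * W j k (uu j k) +
  (\sum_(j in D) \sum_(k in D :\ j) (a (u j) * W j k (uu j k)) +
    \sum_(j in D) \sum_(k in D :\ j) (a (u k) * W j k (u k))) +
  \sum_(j in D) \sum_(k in D :\ j) (a q * W j k (u k))).
  rewrite -!big_split/=; apply: eq_bigr => j _; rewrite -!big_split/=.
  by apply: eq_bigr => k _; rewrite /uu /u /W; ring.
by rewrite T1 T23 T4 !addr0.
Qed.

(** Lower corners of the unit cells that fill the face where every coordinate outside [D] is
    maximal. *)
Definition grid_box D q :=
  [forall j, if j \in D then (q j < p)%N else (q j == p :> nat)].

(** Modulo 2 the slices strictly between the two extreme ones in direction [j] occur twice; the
    slice at [p] is a box of the smaller face. *)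
Lemma sum_telescope (j : 'I_n) D (f : grid -> 'F_2) : (0 < p)%N -> j \in D ->
  \sum_(q | grid_box D q) (f (grid_up q j) + f q) =
  \sum_(q | grid_box (D :\ j) q) f q +
  \sum_(q | grid_box D q && (q j == 0 :> nat)) f q.
Proof.
move=> p0 jD.
pose C q := [forall k, (k != j) ==> if k \in D then (q k < p)%N else (q k == p :> nat)].
have boxE q : grid_box D q = C q && (q j < p)%N.
  apply/forallP/andP => [H|[/forallP H qj] k].
    by split; [apply/forallP => k; apply/implyP => _; exact: H | have := H j; rewrite jD].
  by have [->|kj] := eqVneq k j; rewrite ?jD//; have := H k; rewrite kj.
have boxDE q : grid_box (D :\ j) q = C q && (q j == p :> nat).
  apply/forallP/andP => [H|[/forallP H qj] k].
    split; last by have := H j; rewrite !inE eqxx.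
    by apply/forallP => k; apply/implyP => kj; have := H k; rewrite !inE kj.
  by rewrite !inE; have [->|kj]//= := eqVneq k j; have := H k; rewrite kj.
pose dn q : grid := [ffun k => if k == j then inord (q j).-1 else q k].
have CE q q' : (forall k, k != j -> q k = q' k) -> C q = C q'.
  by move=> H; apply: eq_forallb => k; case: eqVneq => //= kj; rewrite H.
rewrite big_split/=.
have -> : \sum_(q | grid_box D q) f (grid_up q j) =
          \sum_(q | C q && (0 < q j)%N) f q.
  rewrite [RHS](reindex_onto (grid_up^~ j) dn)/=; last first.
    move=> q /andP[_ q0]; apply/ffunP => k; rewrite !ffunE eqxx.
    have [->|//] := eqVneq k j; apply: val_inj => /=.
    have E : (inord (q j).-1 : 'I_p.+1) = (q j).-1 :> nat.
      by rewrite inordK// (leq_ltn_trans (leq_pred _)).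
    by rewrite E prednK// inordK.
  apply: eq_bigl => q; rewrite boxE.
  rewrite (CE (grid_up q j) q); last by move=> k kj; rewrite ffunE (negbTE kj).
  rewrite -andbA; congr (_ && _); rewrite ffunE eqxx.
  apply/idP/andP => [qp|[+ /eqP/ffunP/(_ j)]].
    split; first by rewrite inordK.
    apply/eqP/ffunP => k; rewrite !ffunE; have [->|//] := eqVneq k j.
    by rewrite eqxx; apply: val_inj; rewrite /= !inordK// ltnS ltnW.
  rewrite !ffunE eqxx => q0 /(congr1 val)/=.
  move: q0; case: (ltnP (q j) p) => // pq.
  have -> : (q j = p :> nat) by apply/eqP; rewrite eqn_leq pq -ltnS ltn_ord.
  (* Here [q j = p], so [inord] returns its default 0, against the positivity of the raised
     coordinate. *)
  rewrite /inord val_insubd ltnn /=.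
  by [].
rewrite (bigID (fun q : grid => (q j == p :> nat)))/= -addrA; congr (_ + _).
  by apply: eq_big => // q; rewrite boxDE -andbA; congr (_ && _);
     case: eqP => [->|]; rewrite ?andbT ?andbF.
rewrite [X in _ + X](bigID (fun q : grid => (q j == 0 :> nat)))/= addrCA.
rewrite [X in _ + (X + _)](eq_bigl (fun q => grid_box D q && (q j != 0 :> nat))).
  by rewrite addFF addr0.
move=> q; rewrite boxE -!andbA; congr (_ && _); rewrite lt0n andbC; congr (_ && _).
by rewrite ltn_neqAle -ltnS ltn_ord andbT.
Qed.

Variable a : 'I_n -> grid -> 'F_2.

(** Each path contributes a product containing the variation of [a i] along one of its edges. Fixing
    the coordinates outside [D] admits labels that are constant only on a face. *)
Lemma cup_const (l : seq 'I_n) D q i : i \in l ->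
  (forall q' j, j \in D -> (forall k, k \notin D -> q' k = q k) ->
     a i (grid_up q' j) = a i q') -> cup (map a l) D q = 0.
Proof.
elim: l D q => // i' l IH D q; rewrite inE => il H /=; apply: big1 => j jD.
have [E|ii'] := eqVneq i i'.
  by rewrite -E H// addFF mul0r.
move: il; rewrite (negbTE ii')/= => il; rewrite (IH (D :\ j))// ?mulr0// => q' k.
rewrite !inE => /andP[kj kD] qq'; apply: H => // m mD; rewrite qq'.
  by rewrite ffunE; case: eqP mD => // ->; rewrite jD.
by rewrite !inE (negbTE mD) andbF.
Qed.

Lemma cup_change (l : seq 'I_n) D q : cup (map a l) D q != 0 ->
  (forall j, j \in D -> (q j < p)%N) -> forall i, i \in l ->
  exists r1 r2 : grid, a i r1 != a i r2 /\
    forall k, (q k <= r1 k <= (q k).+1)%N && (q k <= r2 k <= (q k).+1)%N.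
Proof.
suff H : cup (map a l) D q != 0 -> (forall j, j \in D -> (q j < p)%N) ->
  forall i, i \in l -> exists r1 r2 : grid, a i r1 != a i r2 /\
    forall k, if k \in D then
       (q k <= r1 k <= (q k).+1)%N && (q k <= r2 k <= (q k).+1)%N
       else (r1 k == q k) && (r2 k == q k).
  move=> c0 Dp i il; have [r1 [r2 [r12 Hr]]] := H c0 Dp i il.
  exists r1, r2; split=> // k; have := Hr k; case: ifP => // _ /andP[/eqP-> /eqP->].
  by rewrite leqnn leqnSn.
elim: l D q => // i' l IH D q /= c0 Dp i il.
have [j jD] : exists2 j, j \in D &
    (a i' (grid_up q j) + a i' q) * cup (map a l) (D :\ j) (grid_up q j) != 0.
  apply: contrapT => H; case/eqP: c0; apply: big1 => j jD.
  by apply: contrapT => /eqP nz; apply: H; exists j.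
rewrite mulf_eq0 negb_or => /andP[ac cc].
have upj : grid_up q j j = (q j).+1 :> nat by rewrite ffunE eqxx inordK// ltnS Dp.
have upk k : k != j -> grid_up q j k = q k by rewrite ffunE => /negbTE ->.
have [E|ii'] := eqVneq i i'.
  exists (grid_up q j), q; rewrite E; split.
    by apply: contra ac => /eqP ->; rewrite addFF.
  move=> k; have [->|kj] := eqVneq k j; first by rewrite jD upj !leqnn leqnSn.
  by rewrite upk// !eqxx !leqnn leqnSn; case: ifP.
move: il; rewrite inE (negbTE ii')/= => il.
have [|r1 [r2 [r12 Hr]]] := IH _ _ cc _ i il.
  by move=> k; rewrite !inE => /andP[kj kD]; rewrite upk// Dp.
exists r1, r2; split => // k; have := Hr k; rewrite !inE.
have [->|kj]/= := eqVneq k j; last by rewrite upk.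
rewrite jD => /andP[/eqP-> /eqP->]; by rewrite upj leqnn leqnSn.
Qed.

Hypothesis p0 : (0 < p)%N.
Hypothesis a0 : forall i q, q i = 0 :> nat -> a i q = 0.
Hypothesis a1 : forall i q, q i = p :> nat -> a i q = 1.

(** A discrete Stokes formula that removes one label at a time. In direction [i] the label [a i] is
    1 on the upper boundary slice and 0 on the lower one; in another direction [j] the label [a j],
    still present in the product, is constant on each of the two slices. *)
Lemma sum_cup (l : seq 'I_n) : uniq l ->
  \sum_(q | grid_box [set i in l] q) cup (map a l) [set i in l] q = 1.
Proof.
elim: l => [|i l IH] /=.
  move=> _; rewrite (big_pred1 [ffun=> ord_max]) => [|q].
    by rewrite (_ : [set i in [::]] = finset.set0) ?eqxx//; apply/setP => i; rewrite !inE.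
  apply/forallP/eqP => [H|-> k]; last by rewrite !inE ffunE /= eqxx.
  apply/ffunP => k; rewrite ffunE; apply: val_inj; have := H k.
  by rewrite !inE => /eqP.
move=> /andP[il ul]; set D := [set k in i :: l].
have iD : i \in D by rewrite !inE eqxx.
have Di : D :\ i = [set k in l].
  by apply/setP => k; rewrite !inE; case: eqVneq => // ->; rewrite (negbTE il).
pose W j := cup (map a l) (D :\ j).
transitivity (\sum_(j in D) \sum_(q | grid_box D q)
    (a i (grid_up q j) * W j (grid_up q j) + a i q * W j q)).
  rewrite [RHS]exchange_big/=; apply: eq_bigr => q _.
  (* Adding [a i q] times the cocycle identity turns the summand into a total difference in each
     direction. *)
  have Z : \sum_(j in D) a i q * (W j (grid_up q j) + W j q) = 0.
    by rewrite -mulr_sumr cup_closed mulr0.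
  rewrite -[RHS]addr0 -[X in _ = _ + X]Z -big_split; apply: eq_bigr => j _ /=.
  rewrite -/(W j); have := addFF (a i q * W j q).
  set x := a i q * W j q; set y := W j (grid_up q j) => xx.
  rewrite [RHS](_ : _ = a i (grid_up q j) * y + a i q * y + (x + x)); last by rewrite /x; ring.
  by rewrite xx addr0 mulrDl.
rewrite (bigD1 i)//= [X in _ + X]big1 ?addr0.
  rewrite (sum_telescope (fun q => a i q * W i q))// [X in _ + X]big1 ?addr0.
    rewrite -[RHS](IH ul) -Di; apply: eq_bigr => q /forallP/(_ i).
    by rewrite !inE eqxx/= => /eqP qi; rewrite a1// mul1r.
  by move=> q /andP[_ /eqP qi]; rewrite a0// mul0r.
move=> j /andP[jD ji].
have jl : j \in l by move: jD; rewrite !inE (negbTE ji).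
rewrite (sum_telescope (fun q => a i q * W j q))// !big1 ?addr0//.
  move=> q /andP[_ /eqP qj]; rewrite [W j q](cup_const jl) ?mulr0// => q' k.
  rewrite !inE => /andP[kj kD] /(_ j); rewrite !inE eqxx => /(_ isT) q'j.
  by rewrite !a0// ?ffunE 1?eq_sym ?(negbTE kj) q'j.
move=> q /forallP/(_ j); rewrite !inE eqxx/= => /eqP qj.
rewrite [W j q](cup_const jl) ?mulr0// => q' k.
rewrite !inE => /andP[kj kD] /(_ j); rewrite !inE eqxx => /(_ isT) q'j.
by rewrite !a1// ?ffunE 1?eq_sym ?(negbTE kj) q'j.
Qed.

End kuhn.

(** The cup products of all cells add up to 1, so one of them is nonzero, and in that cell every
    label changes. *)
Lemma kuhn (n p : nat) (b : 'I_n -> {ffun 'I_n -> 'I_p.+1} -> bool) :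
  (0 < p)%N -> (forall i (q : {ffun 'I_n -> 'I_p.+1}), q i = 0 :> nat -> ~~ b i q) ->
  (forall i (q : {ffun 'I_n -> 'I_p.+1}), q i = p :> nat -> b i q) ->
  exists q : {ffun 'I_n -> 'I_p.+1}, forall i,
    exists r1 r2 : {ffun 'I_n -> 'I_p.+1}, [/\ ~~ b i r1, b i r2 &
    forall k, (q k <= r1 k <= (q k).+1)%N && (q k <= r2 k <= (q k).+1)%N].
Proof.
move=> p0 b0 b1; pose a i q : 'F_2 := (b i q)%:R.
have a0 i (q : {ffun 'I_n -> 'I_p.+1}) : q i = 0 :> nat -> a i q = 0.
  by move=> /b0; rewrite /a => /negbTE ->.
have a1 i (q : {ffun 'I_n -> 'I_p.+1}) : q i = p :> nat -> a i q = 1.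
  by move=> /b1; rewrite /a => ->.
have := sum_cup p0 a0 a1 (enum_uniq 'I_n).
have -> : [set i in enum 'I_n] = [set: 'I_n]%SET by apply/setP => i; rewrite !inE mem_enum.
move=> S1.
have [q bq cq] : exists2 q, grid_box [set: 'I_n]%SET q &
    cup (map a (enum 'I_n)) [set: 'I_n]%SET q != 0.
  apply: contrapT => H; suff : (0 : 'F_2) = 1 by [].
  rewrite -S1; apply/esym/big1 => q bq.
  by apply: contrapT => /eqP nz; apply: H; exists q.
exists q => i.
have qp j : j \in [set: 'I_n]%SET -> (q j < p)%N.
  by move=> _; move/forallP: bq => /(_ j); rewrite inE.
have [r1 [r2 [r12 Hr]]] := cup_change cq qp (mem_enum 'I_n i).
move: r12; rewrite /a; case E1 : (b i r1); case E2 : (b i r2); rewrite ?eqxx// => _.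
  by exists r2, r1; split=> [||k]; rewrite ?E1 ?E2// andbC.
by exists r1, r2; split; rewrite ?E1 ?E2.
Qed.

(** * Seminorms, and equivalence of norms on row vectors *)

Definition is_seminorm {R : realType} {V : lmodType R} (M : V -> R) :=
  (forall u v, M (u + v) <= M u + M v) /\ (forall t u, M (t *: u) = `|t| * M u).

Definition is_norm {R : realType} {V : lmodType R} (M : V -> R) :=
  is_seminorm M /\ forall u, M u = 0 -> u = 0.

Section seminorm.
Context {R : realType} {V : lmodType R} (M : V -> R).
Hypothesis semi : is_seminorm M.

Lemma seminormD u v : M (u + v) <= M u + M v. Proof. exact: semi.1. Qed.

Lemma seminormZ t u : M (t *: u) = `|t| * M u. Proof. exact: semi.2. Qed.

Lemma seminorm0 : M 0 = 0.
Proof. by rewrite -(scale0r 0) seminormZ normr0 mul0r. Qed.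

Lemma seminormN u : M (- u) = M u.
Proof. by rewrite -scaleN1r seminormZ normrN1 mul1r. Qed.

Lemma seminormBC u v : M (u - v) = M (v - u).
Proof. by rewrite -seminormN opprB. Qed.

Lemma seminorm_ge0 u : 0 <= M u.
Proof.
have := seminormD u (- u); rewrite subrr seminorm0 seminormN -mulr2n.
by rewrite pmulrn_lge0.
Qed.

Lemma seminorm_dist u v : `|M u - M v| <= M (u - v).
Proof.
have H a b : M a - M b <= M (a - b).
  by have := seminormD (a - b) b; rewrite subrK -lerBlDr.
by rewrite ler_norml H lerNl opprB seminormBC H.
Qed.

Lemma seminorm_add0 u v : M v = 0 -> M (u + v) = M u.
Proof.
move=> v0; apply/le_anti/andP; split.
  by rewrite (le_trans (seminormD _ _))// v0 addr0.
by have := seminormD (u + v) (- v); rewrite addrK seminormN v0 addr0.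
Qed.

Lemma seminorm_sum (I : Type) (s : seq I) (P : pred I) (F : I -> V) :
  M (\sum_(i <- s | P i) F i) <= \sum_(i <- s | P i) M (F i).
Proof.
elim/big_rec2: _ => [|i y x _ yx]; first by rewrite seminorm0.
by rewrite (le_trans (seminormD _ _))// lerD2l.
Qed.

Lemma seminorm_sum0 (I : Type) (s : seq I) (P : pred I) (F : I -> V) :
  (forall i, M (F i) = 0) -> M (\sum_(i <- s | P i) F i) = 0.
Proof.
move=> F0; apply/le_anti; rewrite seminorm_ge0 andbT (le_trans (seminorm_sum _ _ _))//.
by rewrite big1.
Qed.

End seminorm.

Section norm_coordinates.
Context {R : realType} {n : nat}.
Implicit Types u v : 'rV[R]_n.

Lemma seminorm_le_coord (M : 'rV[R]_n -> R) : is_seminorm M ->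
  exists2 C, 0 < C & forall u e, 0 <= e -> (forall i, `|u 0 i| <= e) -> M u <= C * e.
Proof.
move=> semi; exists (1 + \sum_i M (delta_mx 0 i)).
  by rewrite ltr_pwDl// sumr_ge0// => i _; exact: seminorm_ge0.
move=> u e e0 ue.
rewrite [u]row_sum_delta (le_trans (seminorm_sum semi _ _ _))//.
rewrite mulrDl mul1r ler_wpDl// mulr_suml ler_sum// => i _.
by rewrite seminormZ// mulrC ler_wpM2l// seminorm_ge0.
Qed.

Lemma coord_lipschitz_continuous (f : 'rV[R]_n -> R) (L : R) : 0 < L ->
  (forall u v e, 0 <= e -> (forall i, `|u 0 i - v 0 i| <= e) -> `|f u - f v| <= L * e) ->
  continuous f.
Proof.
move=> L0 fL u; have FF : Filter (nbhs u) by exact: nbhs_filter.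
apply/cvgrPdist_le => e e0.
have eL : 0 < e / L by exact: divr_gt0.
apply: filterS (nbhsx_ballx u (e / L) eL) => v [_ uv]; rewrite (le_trans (fL u v (e / L) _ _))//.
- by rewrite ltW// divr_gt0.
- by move=> i; apply: ltW; exact: uv.
- by rewrite mulrC divfK// gt_eqF.
Qed.

Lemma norm_ge_coord (N : 'rV[R]_n -> R) : is_norm N ->
  exists2 c, 0 < c & forall u i, c * `|u 0 i| <= N u.
Proof.
move=> [semi N0]; have [C C0 NC] := seminorm_le_coord semi.
have [n0|n0] := posnP n.
  by exists 1 => // u i; exfalso; move: i; rewrite n0 => -[].
(* [F i0] is the face of the cube [[-1, 1]^n] where coordinate [i0] is 1. Dividing a nonzero vector
   by its largest coordinate puts it on one of these faces. *)
pose A (i0 : 'I_n) (i : 'I_n) : set R := if i == i0 then `[1, 1]%classic else `[(-1), 1]%classic.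
pose F i0 := [set u : 'rV[R]_n | forall i, A i0 i (u ord0 i)].
have Ncont : continuous N.
  apply: (@coord_lipschitz_continuous N C) => // u v e e0 uve.
  by rewrite (le_trans (seminorm_dist semi _ _))// NC// => i; rewrite !mxE.
have /choice[c cP] (i0 : 'I_n) : exists c, 0 < c /\ forall u, F i0 u -> c <= N u.
  have cF : compact (F i0).
    by apply: (@rV_compact R n (A i0)) => i; rewrite /A; case: ifP => _; exact: segment_compact.
  have F0 : F i0 !=set0.
    exists (const_mx 1) => i; rewrite /A mxE; case: ifP => _ /=; rewrite in_itv/=; apply/andP; split; lra.
  have [|u uF umin] := @EVT_min_rV R n N (F i0) F0 cF.
    exact: continuous_subspaceT.
  exists (N u); split; last by move=> v vF; apply: umin; exact: mem_set.
  rewrite lt_def (seminorm_ge0 semi) andbT; apply/eqP => /N0 u0.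
  have := set_mem uF; rewrite u0 => /(_ i0); rewrite /A eqxx /= in_itv/= mxE.
  by rewrite ler10.
exists (\big[Order.min/1]_i c i).
  by apply: lt_bigmin => [|i _]; [exact: ltr01 | exact: (cP i).1].
move=> u i; have [i0 _ imax] := @arg_maxP _ _ _ i predT (fun i => `|u 0 i|) isT.
have {}imax j : `|u 0 j| <= `|u 0 i0| by exact: imax.
have [u0|u0] := eqVneq (u 0 i0) 0.
  have -> : u 0 i = 0 by have := imax i; rewrite u0 normr0 normr_le0 => /eqP.
  by rewrite normr0 mulr0 seminorm_ge0.
have ui0 : 0 < `|u 0 i0| by rewrite normr_gt0.
have : c i0 <= N ((u 0 i0)^-1 *: u).
  apply: (cP i0).2 => j; rewrite /A mxE; have [->|ji] := eqVneq j i0.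
    by rewrite mulVf//= in_itv/= lexx.
  rewrite /= in_itv/= -ler_norml normrM normfV mulrC ler_pdivrMr// mul1r.
  exact: imax.
rewrite seminormZ// normfV mulrC ler_pdivlMr//; apply: le_trans.
apply: ler_pM => //.
  by apply: ltW; apply: lt_bigmin => [|k _]; [exact: ltr01 | exact: (cP k).1].
exact: bigmin_le.
Qed.

End norm_coordinates.

(** * The cube with an arbitrary norm and its covering dimension *)

Definition normed_rV {R : realType} {n : nat} (N : 'rV[R]_n -> R) (_ : is_norm N) : Type :=
  'rV[R]_n.

HB.instance Definition _ (R : realType) (n : nat) (N : 'rV[R]_n -> R) (hN : is_norm N) :=
  GRing.Lmodule.copy (normed_rV hN) 'rV[R]_n.

HB.instance Definition _ (R : realType) (n : nat) (N : 'rV[R]_n -> R) (hN : is_norm N) :=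
  Lmodule_isNormed.Build R (normed_rV hN) hN.1.1 hN.1.2 hN.2.

Definition in_cube {R : realType} {n : nat} (u : 'rV[R]_n) :=
  [forall i, 0 <= u 0 i <= 1].

(** The proof of [is_norm N] is carried by the type, as in [normed_rV], so that instance inference
    recovers the norm from the type alone. *)
Definition normed_cube {R : realType} {n : nat} (N : 'rV[R]_n -> R) (_ : is_norm N) : Type :=
  {u : 'rV[R]_n | in_cube u}.

HB.instance Definition _ (R : realType) (n : nat) (N : 'rV[R]_n -> R) (hN : is_norm N) :=
  Choice.copy (normed_cube hN) {u : 'rV[R]_n | in_cube u}.

Section normed_cube_metric.
Context {R : realType} {n : nat} {N : 'rV[R]_n -> R} {hN : is_norm N}.
Implicit Types s t : normed_cube hN.

Definition cube_dist s t : R := N (val s - val t).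

Let cube_distxx s : cube_dist s s = 0.
Proof. by rewrite /cube_dist subrr (seminorm0 hN.1). Qed.

Let cube_dist_positivity s t : cube_dist s t = 0 -> s = t.
Proof. by move=> /hN.2/eqP; rewrite subr_eq0 => /eqP/val_inj. Qed.

Let cube_dist_sym s t : cube_dist s t = cube_dist t s.
Proof. exact: seminormBC hN.1 _ _. Qed.

Let cube_dist_triangle t s u : cube_dist s u <= cube_dist s t + cube_dist t u.
Proof. by rewrite /cube_dist -(subrKA (val t)) hN.1.1. Qed.

HB.instance Definition _ := @isMetric.Build R (normed_cube hN) cube_dist
  cube_distxx cube_dist_positivity cube_dist_sym cube_dist_triangle.

Lemma normed_cube_affine : affine (normed_cube hN).
Proof.
exists (normed_rV hN), val; split=> [//|].
move=> _ _ l /set_mem[s _ <-] /set_mem[t _ <-]; apply/mem_set.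
have Hl : in_cube (l%:num *: val s + (1 - l%:num) *: val t).
  apply/forallP => i; rewrite !mxE.
  have /forallP/(_ i)/andP[s0 s1] := valP s; have /forallP/(_ i)/andP[t0 t1] := valP t.
  have [l0 l1] : 0 <= l%:num /\ l%:num <= 1 by [].
  by apply/andP; split; nra.
by exists (@exist _ (fun u => is_true (in_cube u)) _ Hl).
Qed.

(** Distance to the complement of [W], cut off at 1; the value 1 keeps the infimum meaningful when
    the complement is empty. *)
Definition codist (W : set (normed_cube hN)) (u : 'rV[R]_n) : R :=
  inf [set z | z = 1 \/ exists2 s : normed_cube hN, ~ W s & z = N (u - val s)].

Lemma codist_lbound W u z :
  (forall s : normed_cube hN, ~ W s -> z <= N (u - val s)) -> z <= 1 -> z <= codist W u.
Proof.
move=> zW z1; apply: lb_le_inf; first by exists 1; left.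
by move=> _ [->//|[s Ws ->]]; exact: zW.
Qed.

Lemma codist_ge0 W u : 0 <= codist W u.
Proof. by apply: codist_lbound => // s _; exact: seminorm_ge0 hN.1 _. Qed.

Let codist_has_lbound W u :
  has_lbound [set z | z = 1 \/ exists2 s : normed_cube hN, ~ W s & z = N (u - val s)].
Proof. by exists 0 => _ [->//|[s _ ->]]; exact: seminorm_ge0 hN.1 _. Qed.

Lemma codist_le1 W u : codist W u <= 1.
Proof. by apply: ge_inf => //; left. Qed.

Lemma codist_le (W : set (normed_cube hN)) u (s : normed_cube hN) : ~ W s -> codist W u <= N (u - val s).
Proof. by move=> Ws; apply: ge_inf => //; right; exists s. Qed.

Lemma codist_eq0 (W : set (normed_cube hN)) (s : normed_cube hN) : ~ W s -> codist W (val s) = 0.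
Proof.
move=> Ws; have := codist_le (val s) Ws; rewrite subrr (seminorm0 hN.1) => c0.
by apply/le_anti; rewrite c0 codist_ge0.
Qed.

Lemma codist_gt0 (W : set (normed_cube hN)) (s : normed_cube hN) : open W -> W s -> 0 < codist W (val s).
Proof.
move=> oW Ws; have /nbhs_ballP[e /= e0 We] : nbhs s W by exact: open_nbhs_nbhs.
apply: (@lt_le_trans _ _ (Order.min e 1)); first by rewrite lt_min e0 ltr01.
apply: codist_lbound; last by rewrite ge_min lexx orbT.
move=> t Wt; rewrite ge_min; apply/orP; left; rewrite leNgt; apply/negP => st.
by apply: Wt; apply: We; rewrite ballEmdist.
Qed.

Lemma codist_lip W u v : `|codist W u - codist W v| <= N (u - v).
Proof.
have H a b : codist W a - codist W b <= N (a - b).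
  rewrite lerBlDr -lerBlDl; apply: codist_lbound => [s Ws|].
    rewrite lerBlDl (le_trans (codist_le a Ws))// -(subrKA b) hN.1.1//.
  by rewrite lerBlDl (le_trans (codist_le1 _ _))// lerDr (seminorm_ge0 hN.1).
by rewrite ler_norml H lerNl opprB (seminormBC hN.1) H.
Qed.

End normed_cube_metric.

(** The Poincare-Miranda theorem up to an error: on the grid of mesh [1/p], the cell given by [kuhn]
    has for each [f i] one corner with a value at most 0 and one with a value at least 0. *)
Lemma approx_common_zero {R : realType} (n p : nat) (f : 'I_n -> 'rV[R]_n -> R) (L : R) :
  (0 < p)%N ->
  (forall i (u v : 'rV[R]_n) e, 0 <= e -> (forall j, `|u 0 j - v 0 j| <= e) ->
     `|f i u - f i v| <= L * e) ->
  (forall i (u : 'rV[R]_n), in_cube u -> u 0 i = 0 -> f i u <= 0) ->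
  (forall i (u : 'rV[R]_n), in_cube u -> u 0 i = 1 -> 0 <= f i u) ->
  exists2 u : 'rV[R]_n, in_cube u & forall i, `|f i u| <= L / p%:R.
Proof.
move=> p0 fL f0 f1.
have pR : 0 < p%:R :> R by rewrite ltr0n.
pose pt (q : {ffun 'I_n -> 'I_p.+1}) : 'rV[R]_n := \row_j ((q j)%:R / p%:R).
have ptC q : in_cube (pt q).
  apply/forallP => i; rewrite mxE divr_ge0 ?ler0n//= ler_pdivrMr// mul1r ler_nat.
  by rewrite -ltnS.
(* On the two faces the label is imposed: [f i] may vanish there, and its sign would not decide. *)
pose b i (q : {ffun 'I_n -> 'I_p.+1}) := (q i != 0 :> nat) && ((q i == p :> nat) || (0 <= f i (pt q))).
have [||q qP] := kuhn p0 (b := b).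
- by move=> i q qi; rewrite /b qi.
- by move=> i q qi; rewrite /b qi eqxx/= -lt0n p0.
exists (pt q) => // i; have [r1 [r2 [b1 b2 qr]]] := qP i.
have near (r : {ffun 'I_n -> 'I_p.+1}) : (forall k, q k <= r k <= (q k).+1)%N ->
    `|f i (pt q) - f i (pt r)| <= L / p%:R.
  move=> Hr; apply: fL => [|j]; first by rewrite invr_ge0 ltW.
  rewrite !mxE -mulrBl normrM normfV (ger0_norm (ltW pR)) ler_piMl ?invr_ge0 ?(ltW pR)//.
  have /andP[qr1 qr2] := Hr j; rewrite -(ler_nat R) in qr1.
  rewrite -(ler_nat R) -natr1 in qr2.
  by rewrite ler_norml; apply/andP; split; lra.
have r1n := near r1 (fun k => proj1 (andP (qr k))).
have r2n := near r2 (fun k => proj2 (andP (qr k))).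
have fr1 : f i (pt r1) <= 0.
  move: b1; rewrite /b negb_and negbK => /orP[/eqP z|]; first by apply: f0; rewrite ?mxE ?z ?mul0r.
  by rewrite negb_or -ltNge => /andP[_ /ltW].
have fr2 : 0 <= f i (pt r2).
  move: b2 => /andP[_ /orP[/eqP z|//]]; apply: f1; rewrite ?mxE ?z ?divff//.
  by rewrite gt_eqF.
move: r1n r2n; rewrite !ler_norml => /andP[_ h1] /andP[h2 _].
by apply/andP; split; lra.
Qed.

(* Refine the cover by the sets [t_i > 0] and the set where all [t_i < 1], and
   group the pieces by the member that contains them: some point has the same
   distance to the complements of all these groups. *)
Lemma cube_covers_refinable {R : realType} {n : nat} {N : 'rV[R]_n -> R} (hN : is_norm N) (k : nat) :
  @covers_refinable (normed_cube hN) k -> (n < k)%N.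
Proof.
move=> ref; rewrite ltnNge; apply/negP => kn.
have [c c0 Nc] := norm_ge_coord hN.
have [C C0 NC] := seminorm_le_coord hN.1.
pose U (o : option 'I_n) : set (normed_cube hN) :=
  if o is Some i then [set t | 0 < (val t : 'rV[R]_n) 0 i]
  else [set t | forall i, (val t : 'rV[R]_n) 0 i < 1].
have Uopen o : open (U o).
  rewrite openE => t Ut; apply/nbhs_ballP.
  case: o Ut => [i|] /= Ut.
    exists (c * (val t : 'rV[R]_n) 0 i); first exact: mulr_gt0.
    move=> s; rewrite ballEmdist /= => /(le_lt_trans (Nc _ i)).
    rewrite ltr_pM2l// !mxE ltr_norml => /andP[_]; lra.
  have cf (i : 'I_n) : \big[Order.min/1]_i (1 - (val t : 'rV[R]_n) 0 i) <= 1 - (val t : 'rV[R]_n) 0 i.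
    exact: bigmin_le.
  exists (c * \big[Order.min/1]_i (1 - (val t : 'rV[R]_n) 0 i)).
    by apply: mulr_gt0 => //; apply: lt_bigmin => [|i _]; rewrite ?ltr01// subr_gt0.
  move=> s; rewrite ballEmdist /= => st i; have := le_lt_trans (Nc _ i) st.
  rewrite ltr_pM2l// !mxE => /lt_le_trans/(_ (cf i)).
  rewrite ltr_norml => /andP[+ _]; lra.
have [V [[Vopen Vcov] Vref Vmul]] : exists V, [/\ @open_cover (normed_cube hN) V, refines V (range U) & multiplicity_le V k].
  apply: ref; split; first by move=> _ [oi _ <-].
  apply/seteqP; split => // t _.
  have [Ut|/existsNP[i /negP]] := pselect (U None t); first by exists (U None); [exists None|].
  rewrite -leNgt => ti; exists (U (Some i)); first by exists (Some i).
  by rewrite /U/= (lt_le_trans ltr01).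
have /choice[col colP] (A : set (normed_cube hN)) : exists o, V A -> A `<=` U o.
  have [/Vref[_ [oi _ <-] AU]|nVA] := pselect (V A); first by exists oi.
  by exists None.
pose W o : set (normed_cube hN) := \bigcup_(A in [set A | V A /\ col A = o]) A.
have Wopen o : open (W o) by apply: bigcup_open => A [VA _]; exact: Vopen.
have WU o : W o `<=` U o by move=> t [A [VA <-] At]; exact: colP VA _ At.
have Wcov t : exists o, W o t.
  have : [set: normed_cube hN] t by [].
  by rewrite -Vcov => -[A VA At]; exists (col A), A.
have Wmul t : exists o, ~ W o t.
  apply/existsNP => allW.
  have /choice[B BP] o : exists A, [/\ V A, col A = o & A t] by have [A [? ?] ?] := allW o; exists A.
  (* [insub] enumerates [option 'I_n] by the numbers up to [n], with [n] giving [None]; so [t] would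
     lie in [n + 1] distinct members of [V]. *)
  have Binj : {in `I_n.+1 &, injective (fun m => B (insub m))}.
    move=> m1 m2 /set_mem/= m1n /set_mem/= m2n E.
    have : insub m1 = insub m2 :> option 'I_n.
      by have [_ <- _] := BP (insub m1); have [_ <- _] := BP (insub m2); rewrite E.
    case: insubP => [i1 _ v1|]; case: insubP => [i2 _ v2|] //.
      by move=> [i12]; rewrite -v1 -v2 i12.
    rewrite -!leqNgt => n1 n2 _; apply/eqP; rewrite eqn_leq.
    by rewrite (leq_trans _ n1)// (leq_trans _ n2).
  have : `I_n.+1 #<= `I_k.
    apply: card_le_trans (Vmul t); rewrite -(card_le_eql (inj_card_eq Binj)).
    apply: subset_card_le => _ [m _ <-]; have [VB _ Bt] := BP (insub m).
    by split.
  by rewrite card_le_II ltnNge kn.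
pose f (i : 'I_n) u := codist (W (Some i)) u - codist (W None) u.
pose h u := \sum_o codist (W o) u.
have Wlip o (u v : 'rV[R]_n) e : 0 <= e -> (forall j, `|u 0 j - v 0 j| <= e) ->
    `|codist (W o) u - codist (W o) v| <= C * e.
  move=> e0 uve; rewrite (le_trans (codist_lip _ _ _))// NC// => j.
  by rewrite !mxE.
have hcont : continuous h.
  apply: (@coord_lipschitz_continuous _ _ h (#|{: option 'I_n}|%:R * C)).
    by rewrite mulr_gt0// ltr0n card_option.
  move=> u v e e0 uve; rewrite -sumrB (le_trans (ler_norm_sum _ _ _))//.
  rewrite -mulrA mulr_natl -sumr_const ler_sum// => o _.
  exact: Wlip.
have cube_compact : compact [set u : 'rV[R]_n | forall i, `[(0 : R), 1]%classic (u ord0 i)].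
  by apply: (@rV_compact R n (fun=> `[0, 1]%classic)) => i; exact: segment_compact.
have cubeE (u : 'rV[R]_n) : in_cube u <-> (forall i, `[(0 : R), 1]%classic (u ord0 i)).
  by split => [/forallP H i|H]; [|apply/forallP => i; have := H i]; rewrite /= ?in_itv/=.
have [||u0 u0c u0min] := @EVT_min_rV R n h _ _ cube_compact.
- by exists 0 => i; rewrite /= mxE in_itv/= lexx ler01.
- exact: continuous_subspaceT.
have h0 : 0 < h u0.
  have u0cube : in_cube u0 by apply/cubeE; have := set_mem u0c.
  have [oi Wo] := Wcov (exist (fun u => is_true (in_cube u)) _ u0cube).
  have c1 := codist_gt0 (Wopen oi) Wo; rewrite /= in c1.
  rewrite /h (bigD1 oi)//=; apply: ltr_pwDl => //.
  by apply: sumr_ge0 => o' _; exact: codist_ge0.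
(* At an approximate zero every codistance is within [2 * C / p] of that of [W None]. Since one of
   them is zero, all are at most [4 * C / p], and their sum falls below the positive minimum of
   [h]. *)
pose K := #|{: option 'I_n}|%:R * (4 * C).
pose p := (Num.bound (K / h u0)).+1.
have Kp : K / p%:R < h u0.
  rewrite ltr_pdivrMr ?ltr0n// mulrC -ltr_pdivrMr// (lt_le_trans (archi_boundP _))//.
    by rewrite divr_ge0 ?(ltW h0)// /K !mulr_ge0 ?ler0n// ltW.
  by rewrite ler_nat.
have [||||u uC uP] := @approx_common_zero R n p f (2 * C).
- by [].
- move=> i u v e e0 uve; rewrite /f.
  have := Wlip (Some i) _ _ _ e0 uve; have := Wlip None _ _ _ e0 uve.
  by rewrite !ler_norml => /andP[? ?] /andP[? ?]; apply/andP; split; lra.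
- move=> i u uC ui; rewrite /f (@codist_eq0 _ _ _ _ (W (Some i)) (exist (fun u => is_true (in_cube u)) _ uC)).
    by rewrite sub0r oppr_le0 codist_ge0.
  by move/WU; rewrite /U/= ui ltxx.
- move=> i u uC ui; rewrite /f (@codist_eq0 _ _ _ _ (W None) (exist (fun u => is_true (in_cube u)) _ uC)).
    by rewrite subr0 codist_ge0.
  by move/WU => /(_ i) /=; rewrite ui ltxx.
have [oi Wo] := Wmul (exist (fun u => is_true (in_cube u)) _ uC).
have co := codist_eq0 Wo; rewrite /= in co.
have CN : codist (W None) u <= 2 * C / p%:R.
  case: oi {Wo} co => [i|] co; last by rewrite co divr_ge0// mulr_ge0// ltW.
  by have := uP i; rewrite /f co sub0r normrN ger0_norm// codist_ge0.
have Call o' : codist (W o') u <= 4 * C / p%:R.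
  have P0 : 0 <= C / p%:R by rewrite divr_ge0// ltW.
  case: o' => [i|]; last by rewrite (le_trans CN)// -!mulrA; lra.
  have := uP i; rewrite /f ler_norml => /andP[_]; move: CN; rewrite -!mulrA; lra.
have : h u0 <= h u by apply: u0min; apply/mem_set/cubeE.
rewrite leNgt => /negP; apply; apply: le_lt_trans Kp.
rewrite /K -mulrA mulr_natl -sumr_const; apply: ler_sum => o' _; exact: Call.
Qed.

Lemma affine_rank_bound {R : realType} (X : metricType R) : (affine_rank X < +oo)%E ->
  exists n0 : nat, forall n (N : 'rV[R]_n -> R) (hN : is_norm N) (f : normed_cube hN -> X),
    isometric_embedding f -> (n <= n0)%N.
Proof.
move=> rk.
have [c rc] : exists c : R, (affine_rank X <= c%:E)%E.
  by move: rk; case: (affine_rank X) => [c _|//|_]; [exists c | exists 0; rewrite leNye].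
exists (Num.bound c) => n N hN f fiso.
have : (n%:R%:E <= c%:E)%E.
  apply: le_trans rc; apply: (@le_trans _ _ (topological_dim R (normed_cube hN))).
    apply: le_ereal_inf_tmp => _ [k /cube_covers_refinable nk <-].
    by rewrite lee_fin lerBrDr natr1 ler_nat.
  apply: ereal_sup_ubound; exists (normed_cube hN); split=> //; first exact: normed_cube_affine.
  by exists f.
rewrite lee_fin => nc.
have c0 : 0 <= c by apply: le_trans nc; rewrite ler0n.
by have := le_lt_trans nc (archi_boundP c0); rewrite ltr_nat => /ltnW.
Qed.

(** * Translation invariance of projected distances *)

Ltac row_ring := apply/rowP => ?; rewrite !mxE; ring.
Ltac row_field := apply/rowP => ?; rewrite !mxE; field.

Definition convex_dom {R : realType} {n : nat} (D : set 'rV[R]_n) :=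
  forall u v t, D u -> D v -> 0 <= t <= 1 -> D (u + t *: (v - u)).

(* A pseudometric on [D] for which straight segments are geodesics parametrized
   proportionally to arc length. *)
Definition straight_on {R : realType} {n : nat} (D : set 'rV[R]_n)
    (rho : 'rV[R]_n -> 'rV[R]_n -> R) :=
  [/\ forall u v, rho u v = rho v u,
      forall u v w, D u -> D v -> D w -> rho u w <= rho u v + rho v w &
      forall u v t, D u -> D v -> 0 <= t <= 1 -> rho u (u + t *: (v - u)) = t * rho u v].

Section translation_invariance.
Context {R : realType} {n : nat} (D : set 'rV[R]_n) (rho : 'rV[R]_n -> 'rV[R]_n -> R).
Implicit Types u v w : 'rV[R]_n.
Hypotheses (Dconv : convex_dom D) (straight : straight_on D rho).

Let rhoC u v : rho u v = rho v u. Proof. by case: straight. Qed.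
Let rho_tri u v w : D u -> D v -> D w -> rho u w <= rho u v + rho v w.
Proof. by case: straight => _ + _; apply. Qed.
Let rho_seg u v t : D u -> D v -> 0 <= t <= 1 -> rho u (u + t *: (v - u)) = t * rho u v.
Proof. by case: straight => _ _; apply. Qed.

Lemma straight_ge0 u v : D u -> D v -> 0 <= rho u v.
Proof.
move=> Du Dv; have uu : rho u u = 0.
  by have := @rho_seg u u 0 Du Du; rewrite scale0r addr0 mul0r; apply; rewrite lexx ler01.
have := rho_tri Du Dv Du; rewrite uu (rhoC v u) -mulr2n.
by rewrite pmulrn_lge0.
Qed.

Lemma straight_sub u v s t : D u -> D v -> 0 <= s <= 1 -> 0 <= t <= 1 ->
  rho (u + s *: (v - u)) (u + t *: (v - u)) = `|s - t| * rho u v.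
Proof.
move=> Du Dv; wlog st : s t / s <= t.
  move=> H s01 t01; have [st|ts] := leP s t; first exact: H.
  by rewrite rhoC distrC H// ltW.
move=> s01 t01; have [s0 s1] := andP s01; have [t0 t1] := andP t01.
have [t00|t00] := eqVneq t 0.
  have -> : s = 0 by lra.
  rewrite t00 subrr normr0 mul0r scale0r addr0; have := @rho_seg u u 0 Du Du.
  by rewrite scale0r addr0 mul0r; apply; rewrite lexx ler01.
have tp : 0 < t by lra.
set z := u + t *: (v - u); have Dz : D z by exact: Dconv.
have -> : u + s *: (v - u) = z + (1 - s / t) *: (u - z) by rewrite /z; row_field.
rewrite rhoC rho_seg//; last first.
  by rewrite subr_ge0 lerBlDr lerDl divr_ge0 ?andbT ?(ltW tp)// ler_pdivrMr// mul1r st.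
by rewrite [rho z u]rhoC rho_seg// mulrA mulrBl divfK// mul1r distrC ger0_norm// subr_ge0.
Qed.

Section parallelogram.
Variables (c v w : 'rV[R]_n).
Hypotheses (D00 : D c) (D10 : D (c + v)) (D01 : D (c + w)) (D11 : D (c + w + v)).

Let P (a b : R) := c + b *: w + a *: v.

Let DP a b : 0 <= a <= 1 -> 0 <= b <= 1 -> D (P a b).
Proof.
move=> a01 b01.
have -> : P a b = (c + b *: ((c + w) - c)) + a *:
    ((c + v + b *: ((c + w + v) - (c + v))) - (c + b *: ((c + w) - c))).
  by rewrite /P; row_ring.
by apply: Dconv => //; apply: Dconv.
Qed.

Let g b := rho (P 0 b) (P 1 b).
Let phi b e := rho (P 0 b) (P 1 (b + e)).
Let K := rho (P 0 0) (P 0 1) + rho (P 1 0) (P 1 1).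

Let I0 : 0 <= (0 : R) <= 1. Proof. by rewrite lexx ler01. Qed.
Let I1 : 0 <= (1 : R) <= 1. Proof. by rewrite lexx ler01. Qed.

Let vert a b b' : 0 <= a <= 1 -> 0 <= b <= 1 -> 0 <= b' <= 1 ->
  rho (P a b) (P a b') = `|b - b'| * rho (P a 0) (P a 1).
Proof.
move=> a01 b01 b'01; rewrite -straight_sub; [|exact: DP..|by []|by []].
by congr rho; rewrite /P; row_ring.
Qed.

Let K0 : 0 <= K. Proof. by rewrite addr_ge0// straight_ge0//; exact: DP. Qed.

Let g_lip b b' : 0 <= b <= 1 -> 0 <= b' <= 1 -> g b <= g b' + `|b - b'| * K.
Proof.
move=> b01 b'01; have v0 := vert I0 b01 b'01; have := vert I1 b'01 b01; rewrite distrC => v1.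
rewrite mulrDr -v0 -v1.
have := rho_tri (DP I0 b01) (DP I0 b'01) (DP I1 b01).
have := rho_tri (DP I0 b'01) (DP I1 b'01) (DP I1 b01).
by rewrite /g; lra.
Qed.

Let phi_lip b e : 0 <= b -> 0 <= e -> b + e <= 1 -> `|phi b e - phi b 0| <= e * K.
Proof.
move=> b0 e0 be.
have b01 : 0 <= b <= 1 by lra. have be01 : 0 <= b + e <= 1 by lra.
have V1 : rho (P 1 b) (P 1 (b + e)) <= e * K.
  rewrite vert// opprD addrA subrr sub0r normrN ger0_norm//.
  by rewrite /K mulrDr lerDr mulr_ge0// straight_ge0//; exact: DP.
rewrite /phi addr0 ler_norml.
have := rho_tri (DP I0 b01) (DP I1 b01) (DP I1 be01).
have := rho_tri (DP I0 b01) (DP I1 be01) (DP I1 b01).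
by rewrite (rhoC (P 1 (b + e)) (P 1 b)) => ? ?; apply/andP; split; lra.
Qed.

(* The midpoint of the segment from [P 0 b] to [P 1 (b + 2 e)] lies on the
   horizontal line at height [b + e]. *)
Let g_phi b e : 0 <= b -> 0 <= e -> b + 2 * e <= 1 ->
  2 * phi b e - phi b (2 * e) <= g (b + e).
Proof.
move=> b0 e0 be.
have b01 : 0 <= b <= 1 by lra. have be01 : 0 <= b + e <= 1 by lra.
have bee01 : 0 <= b + 2 * e <= 1 by lra.
have h01 : 0 <= (2^-1 : R) <= 1 by lra.
have D1 := DP I0 b01; have D2 := DP I1 bee01.
have M1 := rho_seg D1 D2 h01.
have E : P 0 b + 2^-1 *: (P 1 (b + 2 * e) - P 0 b) = P 2^-1 (b + e).
  by rewrite /P; row_field.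
rewrite E in M1.
have M2 : rho (P 2^-1 (b + e)) (P 1 (b + e)) = 2^-1 * g (b + e).
  have := straight_sub (DP I0 be01) (DP I1 be01) h01 I1.
  have -> : `|2^-1 - 1| = 2^-1 :> R.
    by rewrite ler0_norm; lra.
  by move=> <-; congr rho; rewrite /P; row_ring.
have := rho_tri D1 (DP h01 be01) (DP I1 be01); rewrite M1 M2 /phi; lra.
Qed.

(* Otherwise the difference quotients of the Lipschitz function [phi b] would
   drop by [eta / 2] each time the scale is halved. *)
Let small_step b eta : 0 <= b -> b < 1 -> 0 < eta ->
  exists2 e, 0 < e & b + e <= 1 /\ g b - eta * e <= g (b + e).
Proof.
move=> b0 b1 eta0; apply: contrapT => H.
pose s e := (phi b e - phi b 0) / e.
pose e_ k := (1 - b) / 2 ^+ k.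
have e0 k : 0 < e_ k by rewrite divr_gt0 ?subr_gt0// exprn_gt0.
have eS k : e_ k = 2 * e_ k.+1 by rewrite /e_ exprS; field; rewrite expf_neq0.
have e1 k : b + e_ k <= 1.
  elim: k => [|k IH]; first by rewrite /e_ expr0 divr1; lra.
  by have := e0 k.+1; move: IH; rewrite eS; lra.
have sK k : `|s (e_ k)| <= K.
  rewrite normrM normfV (gtr0_norm (e0 k)) ler_pdivrMr// mulrC.
  by apply: phi_lip => //; exact: ltW.
have sdec k : s (e_ k.+1) < s (e_ k) - eta / 2.
  have ek := e0 k.+1; rewrite ltNge; apply/negP => sk; apply: H.
  exists (e_ k.+1) => //; split=> //.
  have := @g_phi b (e_ k.+1) b0 (ltW ek); rewrite -eS => /(_ (e1 k)); apply: le_trans.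
  have -> : g b = phi b 0 by rewrite /phi addr0.
  have e2 : 0 < 2 * e_ k.+1 by lra.
  move: sk; rewrite /s (eS k) lerBlDr (ler_pdivrMr _ _ e2) => sk.
  have X : ((phi b (e_ k.+1) - phi b 0) / e_ k.+1 + eta / 2) * (2 * e_ k.+1) =
      2 * (phi b (e_ k.+1) - phi b 0) + eta * e_ k.+1.
    by field; rewrite gt_eqF.
  by move: sk; rewrite X; lra.
have ssum k : s (e_ k) <= s (e_ 0) - k%:R * (eta / 2).
  elim: k => [|k IH]; first by rewrite mul0r subr0.
  have -> : k.+1%:R = k%:R + 1 :> R by rewrite natr1.
  by have := sdec k; lra.
(* After [m] halvings the quotient has dropped by more than [2 * K], although it stays between [-K]
   and [K]. *)
pose m := Num.bound (4 * K / eta).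
have mb : 4 * K / eta < m%:R.
  by apply: archi_boundP; rewrite divr_ge0 ?(ltW eta0)// mulr_ge0.
have := ssum m; have := sK m; have := sK 0; rewrite !ler_norml => /andP[_ h0] /andP[hm _].
by move: mb; rewrite ltr_pdivrMr// => mb; lra.
Qed.

(** By [small_step] the width [g] can be followed from any height below 1 over a further positive
    step with loss at rate at most [eta]. The heights with total loss at most [eta] times the height
    have a supremum, which is one of them by the Lipschitz bound; a further step would pass it
    unless it is 1. *)
Lemma parallelogram_le : rho c (c + v) <= rho (c + w) (c + w + v).
Proof.
have -> : rho c (c + v) = g 0 by rewrite /g /P; congr rho; row_ring.
have -> : rho (c + w) (c + w + v) = g 1 by rewrite /g /P; congr rho; row_ring.
apply/ler_addgt0Pr => eta eta0; rewrite -lerBlDr.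
pose S : set R := [set b | 0 <= b <= 1 /\ g 0 - eta * b <= g b].
have S0 : S 0 by split=> //; rewrite mulr0 subr0.
have Sub : has_sup S by split; [exists 0 | exists 1 => b [/andP[]]].
set t := sup S.
have t0 : 0 <= t by apply: ub_le_sup => //; case: Sub.
have t1 : t <= 1 by apply: ge_sup => [|b [/andP[]]//]; exists 0.
have t01 : 0 <= t <= 1 by rewrite t0.
have St : g 0 - eta * t <= g t.
  apply/ler_addgt0Pr => e e0.
  pose d := e / (K + 1); have K1 : 0 < K + 1 by rewrite ltr_wpDl.
  have d0 : 0 < d by rewrite divr_gt0.
  have [b [b01 bS] bt] := sup_adherent d0 Sub.
  have bt' : b <= t by apply: ub_le_sup => //; case: Sub.
  have := g_lip b01 t01; rewrite distrC ger0_norm ?subr_ge0// => gl.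
  have dK : (t - b) * K <= e.
    apply: (@le_trans _ _ (d * (K + 1))); last by rewrite divfK// gt_eqF.
    by apply: ler_pM; rewrite ?subr_ge0//; move: bt; rewrite -/t; lra.
  have : eta * b <= eta * t by rewrite ler_pM2l.
  by move: gl bS; lra.
have [t1'|t1'] := eqVneq t 1; first by move: St; rewrite t1' mulr1.
have tlt : t < 1 by lra.
have [e e0 [te1 ge]] := small_step t0 tlt eta0.
have : t + e <= t.
  apply: ub_le_sup; first by case: Sub.
  by split; [lra | move: ge St; rewrite mulrDr; lra].
by move: e0; lra.
Qed.

End parallelogram.

Lemma translation_invariant c v w : D c -> D (c + v) -> D (c + w) -> D (c + w + v) ->
  rho c (c + v) = rho (c + w) (c + w + v).
Proof.
move=> D0 D1 D2 D3; apply/le_anti; rewrite parallelogram_le//=.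
have := @parallelogram_le (c + w) v (- w); rewrite [c + w - w]addrK.
by apply.
Qed.

End translation_invariance.

(** * From translation invariance to a seminorm *)

Section seminorm_extension.
Context {R : realType} {n : nat} (D : set 'rV[R]_n) (rho : 'rV[R]_n -> 'rV[R]_n -> R).
Implicit Types a b u v w : 'rV[R]_n.
Hypotheses (Dconv : convex_dom D) (straight : straight_on D rho).
Hypotheses (D0 : D 0) (De : forall i, D (delta_mx 0 i)).

Lemma convex_dom_simplex u : (forall i, 0 <= u 0 i) -> \sum_i u 0 i <= 1 -> D u.
Proof.
suff H (l : seq 'I_n) v : uniq l -> (forall i, 0 <= v 0 i) ->
    (forall i, i \notin l -> v 0 i = 0) -> \sum_(i <- l) v 0 i <= 1 -> D v.
  move=> u0 u1; apply: (H (index_enum 'I_n)); rewrite ?index_enum_uniq// => i.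
  by rewrite mem_index_enum.
elim: l v => [|j l IH] v /=.
  by move=> _ _ v0 _; have -> : v = 0 by apply/rowP => i; rewrite mxE v0.
move=> /andP[jl ul] v0 vl; rewrite big_cons => v1.
have S0 : 0 <= \sum_(i <- l) v 0 i by apply: sumr_ge0.
have [vj1|vj1] := eqVneq (v 0 j) 1.
  suff -> : v = delta_mx 0 j by exact: De.
  apply/rowP => i; rewrite mxE eqxx /=; have [->|ij] := eqVneq i j; first by rewrite vj1.
  have [il|il] := boolP (i \in l); last by rewrite vl// in_cons negb_or ij il.
  have : \sum_(i <- l) v 0 i <= 0 by lra.
  rewrite (big_rem _ il)/= => Sle; have : 0 <= \sum_(y <- rem i l) v 0 y by exact: sumr_ge0.
  by have := v0 i => *; apply/eqP; rewrite eq_le; apply/andP; split; rewrite ?mulr0n; lra.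
have vjlt : 0 < 1 - v 0 j by have := v0 j; rewrite subr_gt0 lt_neqAle vj1/=; lra.
pose w := (1 - v 0 j)^-1 *: (v - v 0 j *: delta_mx 0 j) : 'rV_n.
have wE i : w 0 i = if i == j then 0 else (1 - v 0 j)^-1 * v 0 i.
  rewrite !mxE eqxx /=; have [->|_] := eqVneq i j; first by rewrite mulr1 subrr mulr0.
  by rewrite mulr0 subr0.
have Dw : D w.
  apply: IH => // [i|i il|].
  - by rewrite wE; case: ifP => // _; rewrite mulr_ge0// invr_ge0 ltW.
  - rewrite wE; case: eqVneq => // ij; rewrite [v 0 i]vl; first by rewrite mulr0.
    by rewrite in_cons negb_or ij.
  - rewrite (eq_big_seq (fun i => (1 - v 0 j)^-1 * v 0 i)) => [|i il]; last first.
      by rewrite wE; case: eqP => // ij; rewrite -ij il in jl.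
    by rewrite -mulr_sumr mulrC ler_pdivrMr// mul1r; lra.
suff -> : v = w + v 0 j *: (delta_mx 0 j - w).
  by apply: Dconv => //; have := v0 j => ?; apply/andP; split; lra.
apply/rowP => i; rewrite [w]lock !mxE -lock wE eqxx /=.
have [->|_] := eqVneq i j; first by rewrite mulr1n; ring.
by rewrite mulr0n; field; rewrite gt_eqF.
Qed.

(** The positive and negative parts of a small multiple of [w] lie in the simplex spanned by 0 and
    the basis vectors. *)
Lemma convex_dom_absorbs w :
  exists t a b, [/\ 0 < t, D a, D b & a - b = t *: w].
Proof.
pose sz := 1 + \sum_i `|w 0 i|.
have sz0 : 0 < sz by rewrite ltr_pwDl// sumr_ge0.
pose t := sz^-1; have t0 : 0 < t by rewrite invr_gt0.
have H (f : R -> R) : (forall z, 0 <= f z <= `|z|) -> D (\row_i (t * f (w 0 i))).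
  move=> f0; apply: convex_dom_simplex => [i|].
    by rewrite mxE mulr_ge0 ?(ltW t0)//; have /andP[] := f0 (w 0 i).
  rewrite (eq_bigr (fun i => t * f (w 0 i))) => [|i _]; last by rewrite mxE.
  rewrite -mulr_sumr mulrC ler_pdivrMr// mul1r (@le_trans _ _ (\sum_i `|w 0 i|))//.
    by apply: ler_sum => i _; have /andP[] := f0 (w 0 i).
  by rewrite lerDr.
exists t, (\row_i (t * Num.max (w 0 i) 0)), (\row_i (t * Num.max (- w 0 i) 0)); split=> //.
- apply: (H (fun z => Num.max z 0)) => z; rewrite le_max lexx orbT/= ge_max ler_norm.
  by rewrite normr_ge0.
- apply: (H (fun z => Num.max (- z) 0)) => z; rewrite le_max lexx orbT/= ge_max.
  by rewrite -normrN ler_norm normr_ge0.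
- apply/rowP => i; rewrite !mxE -mulrBr; congr (_ * _).
  by have [h|h] := leP (w 0 i) 0; have [h'|h'] := leP (- w 0 i) 0; lra.
Qed.

(** Translation makes the shorter segment a piece of the longer one. Convexity puts the fourth
    corner of the parallelogram in [D] when [s <= 1]; the other case exchanges the two pairs. *)
Lemma straight_scale a b a' b' s : D a -> D b -> D a' -> D b' -> 0 < s ->
  a - b = s *: (a' - b') -> rho a b = s * rho a' b'.
Proof.
have rhoC u v : rho u v = rho v u by case: straight.
have H a1 b1 a2 b2 t : D a1 -> D b1 -> D a2 -> D b2 -> 0 < t -> t <= 1 ->
    a1 - b1 = t *: (a2 - b2) -> rho a1 b1 = t * rho a2 b2.
  move=> Da1 Db1 Da2 Db2 t0 t1 E.
  have Dh : D (b2 + t *: (a2 - b2)) by apply: Dconv => //; rewrite (ltW t0).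
  have := @translation_invariant R n D rho Dconv straight b1 (t *: (a2 - b2)) (b2 - b1) Db1.
  rewrite -E [b1 + (a1 - b1)]addrC subrK [b1 + (b2 - b1)]addrC subrK => /(_ Da1 Db2).
  rewrite E => /(_ Dh); rewrite [rho a1 b1]rhoC => ->.
  have [_ _ seg] := straight; rewrite seg// ?(ltW t0)//; last by rewrite rhoC.
move=> Da Db Da' Db' s0 E; have [s1|s1] := leP s 1; first exact: H.
rewrite (H a' b' a b s^-1)//; first by rewrite mulrA divff ?mul1r// gt_eqF.
- by rewrite invr_gt0.
- by rewrite invf_le1// ltW.
- by rewrite E scalerA mulVf ?scale1r// gt_eqF.
Qed.

(** [D] contains a cube of radius [ep] around [c0], in which [M] measures the multiple [tau u] of
    [u]. By [straight_scale] base point and multiple are immaterial, so the triangle inequality of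
    [rho] gives subadditivity. *)
Lemma seminorm_extension :
  exists2 M : 'rV[R]_n -> R, is_seminorm M & forall u v, D u -> D v -> rho u v = M (u - v).
Proof.
have [rhoC rho_tri _] := straight.
(* Coordinates in [[0, 2 * ep]] add up to at most [n / (n + 1)], so the cube lies in the simplex. *)
pose ep : R := (2 * n.+1%:R)^-1.
have ep0 : 0 < ep by rewrite invr_gt0 mulr_gt0 ?ltr0n.
pose c0 : 'rV[R]_n := const_mx ep.
have Dc u : (forall i, `|u 0 i| <= ep) -> D (c0 + u).
  move=> ue; have ue' i : - ep <= u 0 i <= ep by rewrite -ler_norml.
  apply: convex_dom_simplex => [i|]; first by rewrite !mxE; have := ue' i; lra.
  apply: (@le_trans _ _ (\sum_(i < n) (2 * ep))).
    by apply: ler_sum => i _; rewrite !mxE; have := ue' i; lra.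
  have -> : 2 * ep = n.+1%:R^-1 by rewrite /ep invfM mulrA divff ?mul1r.
  rewrite sumr_const card_ord -[_ *+ n]mulr_natl.
  by rewrite ler_pdivrMr ?ltr0n// mul1r ler_nat.
have Dc0 : D c0 by rewrite -[c0]addr0; apply: Dc => i; rewrite mxE normr0 ltW.
pose sz u := 1 + \sum_i `|u 0 i|.
have sz0 u : 0 < sz u by rewrite ltr_pwDl// sumr_ge0.
have szi u i : `|u 0 i| <= sz u.
  by rewrite /sz (bigD1 i)//= addrCA lerDl addr_ge0// sumr_ge0.
pose tau u := ep / sz u.
have tau0 u : 0 < tau u by rewrite divr_gt0.
have small t u : 0 <= t -> t * sz u <= ep -> D (c0 + t *: u).
  move=> t0 tu; apply: Dc => i; rewrite mxE normrM ger0_norm//.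
  by apply: le_trans tu; rewrite ler_wpM2l.
have Dtau u : D (c0 + tau u *: u) by apply: small; rewrite ?divfK ?gt_eqF// ltW.
pose M u := (tau u)^-1 * rho c0 (c0 + tau u *: u).
have ME a b u t : D a -> D b -> 0 < t -> a - b = t *: u -> rho a b = t * M u.
  move=> Da Db t0 E; rewrite /M mulrA [rho c0 _]rhoC.
  apply: straight_scale => //; first by rewrite divr_gt0.
  by rewrite [c0 + _]addrC addrK scalerA divfK ?gt_eqF.
exists M; last first.
  by move=> u v Du Dv; rewrite (@ME u v (u - v) 1) ?mul1r ?scale1r.
have M0 u : rho c0 (c0 + tau u *: u) = tau u * M u.
  by rewrite /M mulrA divff ?mul1r// gt_eqF.
split=> [u v|t u].
  pose t := ep / (sz u + sz v).
  have s0 : 0 < sz u + sz v by rewrite addr_gt0.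
  have t0 : 0 < t by rewrite divr_gt0.
  have D1 : D (c0 + t *: u).
    by apply: small; rewrite ?(ltW t0)// /t mulrAC ler_pdivrMr// ler_pM2l// lerDl ltW.
  have D2 : D (c0 + t *: (u + v)).
    apply: Dc => i; rewrite !mxE normrM (gtr0_norm t0) mulrAC ler_pdivrMr// ler_pM2l//.
    by rewrite (le_trans (ler_normD _ _))// lerD.
  have := rho_tri _ _ _ D2 D1 Dc0.
  rewrite (@ME _ _ (u + v) t D2 Dc0 t0); last by row_ring.
  rewrite (@ME _ _ v t D2 D1 t0); last by row_ring.
  rewrite (@ME _ _ u t D1 Dc0 t0); last by row_ring.
  by rewrite -mulrDr ler_pM2l// [M v + _]addrC.
have [t0|t0] := ltP 0 t.
  rewrite gtr0_norm// -[LHS]mul1r; apply: (mulfI (lt0r_neq0 (tau0 (t *: u)))).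
  rewrite mul1r -M0 mulrA rhoC; apply: ME => //; first by rewrite mulr_gt0.
  by rewrite [c0 + _]addrC addrK scalerA.
have [->|tn0] := eqVneq t 0.
  rewrite normr0 mul0r scale0r /M scaler0 addr0.
  have h : rho c0 c0 = 0.
    have [_ _ seg] := straight; have := seg c0 c0 0 Dc0 Dc0; rewrite scale0r addr0 mul0r; apply.
    by rewrite lexx ler01.
  by rewrite h mulr0.
have tneg : 0 < - t by rewrite oppr_gt0 lt_neqAle tn0.
rewrite ltr0_norm -?oppr_gt0//; apply: (mulfI (lt0r_neq0 (tau0 (t *: u)))).
rewrite -M0 mulrA; apply: ME => //; first by rewrite mulr_gt0.
by rewrite scalerA; row_ring.
Qed.

End seminorm_extension.

(** * Flats *)

Definition is_pseudometric {R : realType} {X : Type} (d : X -> X -> R) :=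
  [/\ forall p, d p p = 0, forall p q, d p q = d q p &
      forall p q r, d p r <= d p q + d q r].

(* A decomposition of [X] as a direct product, seen from [X]: the distances
   between the projections to both factors, and the point [mix p q] with the
   first coordinate of [p] and the second coordinate of [q]. *)
Record decomposition {R : realType} (X : metricType R) := Decomposition {
  dist1 : X -> X -> R;
  dist2 : X -> X -> R;
  mix : X -> X -> X;
  dist1_pseudometric : is_pseudometric dist1;
  dist2_pseudometric : is_pseudometric dist2;
  mdist_pythagoras : forall p q, mdist p q ^+ 2 = dist1 p q ^+ 2 + dist2 p q ^+ 2;
  dist1_mix : forall p q, dist1 (mix p q) p = 0;
  dist2_mix : forall p q, dist2 (mix p q) q = 0 }.

Section pseudometric.
Context {R : realType} {X : Type} (d : X -> X -> R).
Hypothesis pm : is_pseudometric d.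

Lemma pseudometric_ge0 p q : 0 <= d p q.
Proof.
have [dxx dC dtri] := pm; have := dtri p q p; rewrite dxx (dC q p) -mulr2n.
by rewrite pmulrn_lge0.
Qed.

Lemma pseudometric_eql p p' q : d p p' = 0 -> d p q = d p' q.
Proof.
have [_ dC dtri] := pm; move=> pp'; apply/le_anti/andP; split.
  by have := dtri p p' q; rewrite pp' add0r.
by have := dtri p' p q; rewrite (dC p' p) pp' add0r.
Qed.

End pseudometric.

Section decomposition_theory.
Context {R : realType} {X : metricType R}.
Implicit Types p q m : X.

(** Transparent, so that [dist1 (swap d)] converts to [dist2 d] and facts on the first factor serve
    for the second. *)
Definition swap (d : decomposition X) : decomposition X.
Proof.
refine (@Decomposition R X (dist2 d) (dist1 d) (fun p q => mix d q p)
  (dist2_pseudometric d) (dist1_pseudometric d) _ _ _).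
- by move=> p q; rewrite addrC (mdist_pythagoras d).
- by move=> p q; exact: dist2_mix.
- by move=> p q; exact: dist1_mix.
Defined.

Variable d : decomposition X.

Lemma dist1_mixE p q p' q' : dist1 d (mix d p q) (mix d p' q') = dist1 d p p'.
Proof.
have pm := dist1_pseudometric d; have [_ dC _] := pm.
rewrite (pseudometric_eql pm _ (dist1_mix d p q)) dC.
by rewrite (pseudometric_eql pm _ (dist1_mix d p' q')) dC.
Qed.

Lemma dist2_mixE p q p' q' : dist2 d (mix d p q) (mix d p' q') = dist2 d q q'.
Proof.
have pm := dist2_pseudometric d; have [_ dC _] := pm.
rewrite (pseudometric_eql pm _ (dist2_mix d p q)) dC.
by rewrite (pseudometric_eql pm _ (dist2_mix d p' q')) dC.
Qed.

Lemma dist12_eq0 p q : dist1 d p q = 0 -> dist2 d p q = 0 -> p = q.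
Proof.
move=> d1 d2; apply: (@mdist_positivity R X).
by apply/eqP; rewrite -sqrf_eq0 (mdist_pythagoras d) d1 d2 expr0n addr0.
Qed.

Lemma mixxx p : mix d p p = p.
Proof. by apply: dist12_eq0; [exact: dist1_mix | exact: dist2_mix]. Qed.

Lemma mdist_mix p q p' q' :
  mdist (mix d p q) (mix d p' q') ^+ 2 = dist1 d p p' ^+ 2 + dist2 d q q' ^+ 2.
Proof. by rewrite (mdist_pythagoras d) dist1_mixE dist2_mixE. Qed.

(** The equality case of the Minkowski inequality: the triangle inequalities in the two factors
    leave no slack, because their combination is an equality along a geodesic. *)
Lemma dist1_collinear p m q s : 0 <= s <= 1 ->
  mdist p m = s * mdist p q -> mdist m q = (1 - s) * mdist p q ->
  dist1 d p m = s * dist1 d p q.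
Proof.
move=> /andP[s0 s1] pm mq.
have P1 := dist1_pseudometric d; have P2 := dist2_pseudometric d.
have [_ _ /(_ p m q) t1] := P1; have [_ _ /(_ p m q) t2] := P2.
have := mdist_pythagoras d p m; have := mdist_pythagoras d m q; have := mdist_pythagoras d p q.
have := pseudometric_ge0 P1 p m; have := pseudometric_ge0 P1 m q.
have := pseudometric_ge0 P1 p q; have := pseudometric_ge0 P2 p q.
have := pseudometric_ge0 P2 p m; have := pseudometric_ge0 P2 m q.
rewrite pm mq; move: t1 t2.
move: (dist1 d p m) (dist1 d m q) (dist1 d p q) (dist2 d p m) (dist2 d m q) (dist2 d p q) (mdist p q).
move=> a1 a2 a b1 b2 b L t1 t2 b20 b10 b0 a0 a20 a10 E E2 E1.
have A : a ^+ 2 <= (a1 + a2) ^+ 2 by rewrite lerXn2r// nnegrE addr_ge0.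
have B : b ^+ 2 <= (b1 + b2) ^+ 2 by rewrite lerXn2r// nnegrE addr_ge0.
(* The two squares measure how far the projected lengths are from the ratio [s : 1 - s]. *)
have Z : ((1 - s) * a1 - s * a2) ^+ 2 + ((1 - s) * b1 - s * b2) ^+ 2 <= 0.
  have -> : ((1 - s) * a1 - s * a2) ^+ 2 + ((1 - s) * b1 - s * b2) ^+ 2 =
    (1 - s) * (a1 ^+ 2 + b1 ^+ 2) + s * (a2 ^+ 2 + b2 ^+ 2)
    - s * (1 - s) * ((a1 + a2) ^+ 2 + (b1 + b2) ^+ 2) by ring.
  rewrite -E1 -E2.
  have -> : (1 - s) * (s * L) ^+ 2 + s * ((1 - s) * L) ^+ 2 = s * (1 - s) * L ^+ 2 by ring.
  rewrite -mulrBr mulr_ge0_le0// ?mulr_ge0// ?subr_ge0// subr_le0 E.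
  exact: lerD.
have Z1 : (1 - s) * a1 - s * a2 = 0.
  apply/eqP; rewrite -sqrf_eq0; apply/eqP/le_anti; rewrite sqr_ge0 andbT.
  by have := sqr_ge0 ((1 - s) * b1 - s * b2); lra.
have E3 : (a1 + a2) ^+ 2 <= a ^+ 2.
  have Z2 : (1 - s) * b1 - s * b2 = 0.
    apply/eqP; rewrite -sqrf_eq0; apply/eqP/le_anti; rewrite sqr_ge0 andbT.
    by move: Z; rewrite Z1 expr0n add0r.
  have a1E : a1 = s * (a1 + a2) by lra.
  have b1E : b1 = s * (b1 + b2) by lra.
  have a2E : a2 = (1 - s) * (a1 + a2) by lra.
  have b2E : b2 = (1 - s) * (b1 + b2) by lra.
  suff : (a1 + a2) ^+ 2 + (b1 + b2) ^+ 2 = L ^+ 2 by lra.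
  have F1 : s ^+ 2 * ((a1 + a2) ^+ 2 + (b1 + b2) ^+ 2) = s ^+ 2 * L ^+ 2.
    by rewrite mulrDr -!exprMn -a1E -b1E E1.
  have F2 : (1 - s) ^+ 2 * ((a1 + a2) ^+ 2 + (b1 + b2) ^+ 2) = (1 - s) ^+ 2 * L ^+ 2.
    by rewrite mulrDr -!exprMn -a2E -b2E E2.
  have [s00|s00] := eqVneq s 0; last exact: (mulfI (expf_neq0 2 s00)).
  by move: F2; rewrite s00 subr0 expr1n !mul1r.
have : a1 + a2 <= a by rewrite -(ler_pXn2r (n := 2))// nnegrE addr_ge0.
move=> le; have -> : a = a1 + a2 by apply/le_anti; rewrite t1 le.
by lra.
Qed.

End decomposition_theory.

Section flats.
Context {R : realType} {X : metricType R} (x : X).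

(* A flat through [x], given by the graph of an isometric parametrization by a
   convex set of vectors with a seminorm. *)
Definition flat {n} (M : 'rV[R]_n -> R) (G : set ('rV[R]_n * X)) :=
  [/\ is_seminorm M,
      forall u v p q, G (u, p) -> G (v, q) -> mdist p q = M (u - v),
      forall u v p q t, G (u, p) -> G (v, q) -> 0 <= t <= 1 ->
        exists m, G (u + t *: (v - u), m) &
      G (0, x)].

(** The basis vectors, with 0, make the convex domain full-dimensional; as the norm is definite, [n]
    is the true dimension of the flat. *)
Definition framed_flat {n} (N : 'rV[R]_n -> R) (G : set ('rV[R]_n * X)) :=
  [/\ flat N G, forall u, N u = 0 -> u = 0 & forall i, exists p, G (delta_mx 0 i, p)].

Definition points {n} (G : set ('rV[R]_n * X)) : set X := snd @` G.

Lemma flat_fun {n} (M : 'rV[R]_n -> R) G u p q :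
  flat M G -> G (u, p) -> G (u, q) -> p = q.
Proof.
move=> [semi iso _ _] up uq; apply: (@mdist_positivity R X).
by rewrite (iso _ _ _ _ up uq) subrr seminorm0.
Qed.

Section frame.
Context {n : nat} (N : 'rV[R]_n -> R) (G : set ('rV[R]_n * X)).
Implicit Types u v w : 'rV[R]_n.
Hypothesis fG : framed_flat N G.

Let D : set 'rV[R]_n := [set u | exists p, G (u, p)].
Let psi u : X := xget x [set p | G (u, p)].
Let psiP u p : G (u, p) -> psi u = p.
Proof.
move=> up; have [fl _ _] := fG; apply: (flat_fun fl _ up).
exact: (@xgetPex _ x [set p | G (u, p)] (ex_intro _ p up)).
Qed.

Let Dconv : convex_dom D.
Proof.
have [[_ _ conv _] _ _] := fG; move=> u v t [p up] [q vq] t01.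
by have [m um] := conv _ _ _ _ _ up vq t01; exists m.
Qed.

Let D0 : D 0. Proof. by have [[_ _ _ ?] _ _] := fG; exists x. Qed.
Let De i : D (delta_mx 0 i). Proof. by have [_ _] := fG; apply. Qed.

Lemma framed_simplex u : (forall i, 0 <= u 0 i) -> \sum_i u 0 i <= 1 -> exists p, G (u, p).
Proof. exact: (convex_dom_simplex Dconv D0 De). Qed.

Lemma framed_absorbs w :
  exists t a b p q, [/\ 0 < t, G (a, p), G (b, q) & a - b = t *: w].
Proof.
have [t [a [b [t0 [p ap] [q bq] E]]]] := convex_dom_absorbs Dconv D0 De w.
by exists t, a, b, p, q.
Qed.

(* Projections of straight segments are again geodesics, so the distance
   between projections is translation invariant by [translation_invariant]. *)
Lemma dist1_seminorm (d : decomposition X) :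
  exists2 rho : 'rV[R]_n -> R, is_seminorm rho &
    forall u v p q, G (u, p) -> G (v, q) -> dist1 d p q = rho (u - v).
Proof.
have [[semi iso conv _] _ _] := fG.
have [_ dC dtri] := dist1_pseudometric d.
have [|M sM MP] := @seminorm_extension R n D (fun u v => dist1 d (psi u) (psi v)) Dconv _ D0 De.
  split=> [u v|u v w _ _ _|u v t [p up] [q vq] t01]; [exact: dC|exact: dtri|].
  have [m um] := conv _ _ _ _ _ up vq t01.
  rewrite (psiP up) (psiP vq) (psiP um); have [t0 t1] := andP t01.
  apply: dist1_collinear => //.
    rewrite (iso _ _ _ _ up um) (iso _ _ _ _ up vq).
    rewrite (_ : _ - _ = t *: (u - v)); last by row_ring.
    by rewrite seminormZ// ger0_norm.
  rewrite (iso _ _ _ _ um vq) (iso _ _ _ _ up vq).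
  rewrite (_ : _ - _ = (1 - t) *: (u - v)); last by row_ring.
  by rewrite seminormZ// ger0_norm// subr_ge0.
exists M => // u v p q up vq; rewrite -MP; [|by exists p|by exists q].
by rewrite (psiP up) (psiP vq).
Qed.

Lemma framed_pythagoras (d : decomposition X) (rho1 rho2 : 'rV[R]_n -> R) :
  is_seminorm rho1 -> is_seminorm rho2 ->
  (forall u v p q, G (u, p) -> G (v, q) -> dist1 d p q = rho1 (u - v)) ->
  (forall u v p q, G (u, p) -> G (v, q) -> dist2 d p q = rho2 (u - v)) ->
  forall w, N w ^+ 2 = rho1 w ^+ 2 + rho2 w ^+ 2.
Proof.
have [[semi iso _ _] _ _] := fG.
move=> s1 s2 E1 E2 w; have [t [a [b [p [q [t0 ap bq abw]]]]]] := framed_absorbs w.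
have t2 : `|t| ^+ 2 != 0 by rewrite sqrf_eq0 normr_eq0 gt_eqF.
apply: (mulfI t2); rewrite mulrDr -!exprMn.
rewrite -(seminormZ semi) -(seminormZ s1) -(seminormZ s2) -abw.
by rewrite -(iso _ _ _ _ ap bq) -(E1 _ _ _ _ ap bq) -(E2 _ _ _ _ ap bq) (mdist_pythagoras d).
Qed.

Lemma framed_dim_bound n0 :
  (forall n (N : 'rV[R]_n -> R) (hN : is_norm N) (f : normed_cube hN -> X),
    isometric_embedding f -> (n <= n0)%N) -> (n <= n0)%N.
Proof.
have [[semi iso _ _] N0 _] := fG; move=> bound.
have h0 : (n.+1%:R : R)^-1 != 0 by rewrite invr_eq0.
(* The unit cube shrunk by the factor [n + 1] fits into the simplex that every framed flat contains;
   the norm absorbs the factor. *)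
have hN : is_norm (fun u => N ((n.+1%:R : R)^-1 *: u)).
  split; last by move=> u /N0/eqP; rewrite scaler_eq0 (negbTE h0) => /eqP.
  split=> [u v|t u]; first by rewrite scalerDr seminormD.
  by rewrite scalerA mulrC -scalerA seminormZ.
have simp (s : normed_cube hN) : exists p, G ((n.+1%:R : R)^-1 *: val s, p).
  have /forallP sc := valP s; apply: framed_simplex => [i|].
    by rewrite mxE mulr_ge0 ?invr_ge0//; have /andP[] := sc i.
  rewrite (eq_bigr (fun i => n.+1%:R^-1 * val s 0 i)) => [|i _]; last by rewrite mxE.
  rewrite -mulr_sumr mulrC ler_pdivrMr ?ltr0n// mul1r.
  apply: (@le_trans _ _ (\sum_(i < n) 1)); last by rewrite sumr_const card_ord ler_nat.
  by apply: ler_sum => i _; have /andP[] := sc i.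
apply: (bound n _ hN (fun s => psi ((n.+1%:R : R)^-1 *: val s))).
move=> s t; have [p sp] := simp s; have [q tq] := simp t.
by rewrite (psiP sp) (psiP tq) (iso _ _ _ _ sp tq) -scalerBr.
Qed.

End frame.
End flats.

(** * Products of projections, and passage to independent coordinates *)

Section joins.
Context {R : realType} {X : metricType R} (x : X) (d : decomposition X).
Context {n n' : nat}.

(** The coordinates of both flats are kept side by side. They may be redundant, as a projection can
    collapse directions; hence flats with a degenerate seminorm. *)
Definition join_graph (G : set ('rV[R]_n * X)) (G' : set ('rV[R]_n' * X)) :
    set ('rV[R]_(n + n') * X) :=
  [set z | exists p q, [/\ G (lsubmx z.1, p), G' (rsubmx z.1, q) & z.2 = mix d p q]].

Definition join_norm (rho1 : 'rV[R]_n -> R) (rho2 : 'rV[R]_n' -> R) (w : 'rV[R]_(n + n')) :=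
  Num.sqrt (rho1 (lsubmx w) ^+ 2 + rho2 (rsubmx w) ^+ 2).

Lemma join_norm_seminorm rho1 rho2 :
  is_seminorm rho1 -> is_seminorm rho2 -> is_seminorm (join_norm rho1 rho2).
Proof.
move=> s1 s2; split=> [u v|t u]; rewrite /join_norm.
  pose a b := if b then rho1 (lsubmx u) else rho2 (rsubmx u).
  pose c b := if b then rho1 (lsubmx v) else rho2 (rsubmx v).
  have := @sum_minkowski R bool a c; rewrite !big_bool/=; apply: le_trans.
  by apply: ler_wsqrtr; apply: lerD; rewrite linearD/=; apply: lerXn2r;
    rewrite ?nnegrE ?addr_ge0 ?(seminorm_ge0 s1) ?(seminorm_ge0 s2)// ?(seminormD s1) ?(seminormD s2).
rewrite !linearZ/= (seminormZ s1) (seminormZ s2) !exprMn -mulrDr sqrtrM ?sqr_ge0//.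
by rewrite sqrtr_sqr normr_id.
Qed.

Lemma join_flat (N : 'rV[R]_n -> R) (N' : 'rV[R]_n' -> R) G G' rho1 rho2 :
  flat x N G -> flat x N' G' -> is_seminorm rho1 -> is_seminorm rho2 ->
  (forall u v p q, G (u, p) -> G (v, q) -> dist1 d p q = rho1 (u - v)) ->
  (forall u v p q, G' (u, p) -> G' (v, q) -> dist2 d p q = rho2 (u - v)) ->
  flat x (join_norm rho1 rho2) (join_graph G G').
Proof.
move=> [_ _ conv Gx] [_ _ conv' Gx'] s1 s2 E1 E2; split.
- exact: join_norm_seminorm.
- move=> u v P Q [p [q [/= up uq PE]]] [p' [q' [/= vp' vq' QE]]].
  rewrite PE QE /join_norm !linearB/= -(E1 _ _ _ _ up vp') -(E2 _ _ _ _ uq vq') -mdist_mix.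
  by rewrite sqrtr_sqr ger0_norm// mdist_ge0.
- move=> u v P Q t [p [q [/= up uq PE]]] [p' [q' [/= vp' vq' QE]]] t01.
  have [m um] := conv _ _ _ _ _ up vp' t01; have [m' um'] := conv' _ _ _ _ _ uq vq' t01.
  exists (mix d m m'), m, m'; split=> //=.
    by rewrite linearD linearZ linearB.
  by rewrite linearD linearZ linearB.
- by exists x, x; rewrite /= !linear0 mixxx.
Qed.

End joins.

Section reduction.
Context {R : realType} {X : metricType R} (x : X).

Definition independent_in {k s} (M : 'rV[R]_k -> R) (G : set ('rV[R]_k * X)) (B : 'M[R]_(s, k)) :=
  (forall i, exists p, G (row i B, p)) /\ forall c : 'rV[R]_s, M (c *m B) = 0 -> c = 0.

Lemma independent_le {k s} (M : 'rV[R]_k -> R) G (B : 'M[R]_(s, k)) :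
  is_seminorm M -> independent_in M G B -> (s <= k)%N.
Proof.
move=> sM [_ B0]; have : row_free B.
  rewrite -kermx_eq0; apply/eqP/row_matrixP => i; rewrite row0; apply: B0.
  by rewrite -row_mul mulmx_ker row0 (seminorm0 sM).
by move=> /eqP <-; exact: rank_leq_col.
Qed.

(** A maximal system of rows in the domain, independent modulo the kernel of [M], spans the domain
    modulo that kernel; coordinates in it become the new parameters. *)
Lemma flat_reduce {k s} (M : 'rV[R]_k -> R) G (B : 'M[R]_(s, k)) :
  flat x M G -> independent_in M G B ->
  exists r (N : 'rV[R]_r -> R) (G' : set ('rV[R]_r * X)),
    [/\ (s <= r)%N, framed_flat x N G' & points G `<=` points G'].
Proof.
move=> [sM iso conv Gx] BI.
pose P s := `[< exists B : 'M[R]_(s, k), independent_in M G B >].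
have exP : exists s, P s by exists s; apply/asboolP; exists B.
have leP s' : P s' -> (s' <= k)%N.
  by move=> /asboolP[B']; exact: independent_le.
case: (ex_maxnP exP leP) => r /asboolP[B' [B'G B'0]] rmax {leP}.
have sr : (s <= r)%N by apply: rmax; apply/asboolP; exists B.
have dep u p : G (u, p) -> exists c : 'rV[R]_r, M (u - c *m B') = 0.
  move=> up; have : ~ independent_in M G (col_mx B' u).
    move=> ind; have : (r + 1 <= r)%N by apply: rmax; apply/asboolP; exists (col_mx B' u).
    by rewrite addn1 ltnn.
  move=> nind; have [c [Mc c0]] : exists c, M (c *m col_mx B' u) = 0 /\ c <> 0.
    apply: contrapT => H; apply: nind; split=> [i|c Mc].
      case: (split_ordP i) => j ->; first by rewrite rowKu; exact: B'G.
      by exists p; rewrite rowKd [row j u](_ : _ = u)//; apply/rowP => i'; rewrite mxE ord1.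
    by apply: contrapT => c0; apply: H; exists c.
  rewrite -[c]hsubmxK mul_row_col in Mc.
  set a := lsubmx c in Mc; set b := rsubmx c in Mc.
  have bE : b *m u = b 0 0 *: u by rewrite {1}[b]mx11_scalar mul_scalar_mx.
  have b0 : b 0 0 != 0.
    apply/eqP => b0; move: Mc; rewrite bE b0 scale0r addr0 => /B'0 a0.
    apply: c0; rewrite -[c]hsubmxK -/a -/b a0 [b]mx11_scalar b0 raddf0.
    by rewrite row_mx0.
  exists (- (b 0 0)^-1 *: a).
  have -> : u - (- (b 0 0)^-1 *: a) *m B' = (b 0 0)^-1 *: (a *m B' + b *m u).
    rewrite bE scalerDr scalerA mulVf// scale1r -scalemxAl scaleNr opprK addrC.
    by [].
  by rewrite (seminormZ sM) Mc mulr0.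
pose G' : set ('rV[R]_r * X) := [set z | exists2 u, G (u, z.2) & M (u - z.1 *m B') = 0].
pose N (c : 'rV[R]_r) := M (c *m B').
exists r, N, G'; split=> //; last first.
  by move=> _ [[u p] up <-]; have [c Mc] := dep u p up; exists (c, p) => //; exists u.
split; [split | |].
- by split=> [u v|t u]; rewrite /N ?mulmxDl ?(seminormD sM)// -scalemxAl (seminormZ sM).
- move=> c c' p q [u /= up Mu] [v /= vq Mv]; rewrite (iso _ _ _ _ up vq) /N.
  rewrite -(seminorm_add0 sM _ Mv) -[RHS](seminorm_add0 sM _ Mu); congr M.
  by rewrite mulmxBl; apply/rowP => i; rewrite !mxE; ring.
- move=> c c' p q t [u /= up Mu] [v /= vq Mv] t01.
  have [m um] := conv _ _ _ _ _ up vq t01; exists m, (u + t *: (v - u)) => //=.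
  rewrite (_ : _ - _ = (1 - t) *: (u - c *m B') + t *: (v - c' *m B')); last first.
    by rewrite mulmxDl -scalemxAl mulmxBl; apply/rowP => i; rewrite !mxE; ring.
  by rewrite (seminorm_add0 sM) (seminormZ sM) ?Mu ?Mv mulr0.
- by exists 0 => //=; rewrite mul0mx subr0 (seminorm0 sM).
- by move=> c; exact: B'0.
- move=> i; have [p ip] := B'G i; exists p, (row i B') => //=.
  by rewrite -rowE subrr (seminorm0 sM).
Qed.

End reduction.

(** * Flats that are products for both decompositions *)

Section saturation.
Context {R : realType} {X : metricType R} (x : X).

(** [A], acting on rows from the right, projects onto the directions of the first factor along those
    of the second. *)
Definition splitting {r} (d : decomposition X) (N : 'rV[R]_r -> R) (G : set ('rV[R]_r * X))
    (A : 'M[R]_r) :=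
  [/\ A *m A = A,
      forall w, N w ^+ 2 = N (w *m A) ^+ 2 + N (w *m (1%:M - A)) ^+ 2,
      forall u v p q, G (u, p) -> G (v, q) -> dist1 d p q = N ((u - v) *m A) &
      forall u v p q, G (u, p) -> G (v, q) -> dist2 d p q = N ((u - v) *m (1%:M - A))].

Definition mix_closed {r} (d : decomposition X) (G : set ('rV[R]_r * X)) (A : 'M[R]_r) :=
  forall u v p q, G (u, p) -> G (v, q) -> G (u *m A + v *m (1%:M - A), mix d p q).

Lemma mulmx1B {r} (w : 'rV[R]_r) (A : 'M[R]_r) : w *m (1%:M - A) = w - w *m A.
Proof. by rewrite mulmxBr mulmx1. Qed.

Lemma mulmx_ext {r s} (A B : 'M[R]_(r, s)) : (forall w : 'rV_r, w *m A = w *m B) -> A = B.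
Proof. by move=> H; apply/row_matrixP => i; rewrite !rowE. Qed.

(* A flat of maximal dimension loses no dimension when it is enlarged to the
   product of its two projections, so the kernels of the two projections span. *)
Lemma maximal_splitting {r} (d : decomposition X) (N : 'rV[R]_r -> R) G :
  framed_flat x N G ->
  (forall r' (N' : 'rV[R]_r' -> R) G', framed_flat x N' G' ->
     points G `<=` points G' -> (r' <= r)%N) ->
  exists A, splitting d N G A.
Proof.
move=> fG rmax; have [flG N0 fr] := fG; have [sN iso conv Gx] := flG.
have [rho1 s1 E1] := dist1_seminorm fG d.
have [rho2 s2 E2] := dist1_seminorm fG (swap d).
have pyth := framed_pythagoras fG s1 s2 E1 E2.
have flJ := join_flat flG flG s1 s2 E1 E2.
have GJ : points G `<=` points (join_graph d G G).
  by move=> p [[u q] uq <-]; exists (row_mx u u, q) => //; exists q, q;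
     rewrite /= row_mxKl row_mxKr mixxx.
have /choice[a aP] (j : 'I_r) : exists a : 'rV[R]_r,
    rho1 (delta_mx 0 j - a) = 0 /\ rho2 a = 0.
  (* The diagonal rows parametrize [G] itself inside the join. By maximality the extra row
     [(e_j, 0)] depends on them, and the relation splits [e_j] between the kernels of [rho1] and
     [rho2]. *)
  pose B := col_mx (row_mx 1%:M 1%:M) (row_mx (delta_mx 0 j : 'rV[R]_r) 0).
  have : ~ independent_in (join_norm rho1 rho2) (join_graph d G G) B.
    move=> ind; have [r' [N' [G' [sr fG' JG']]]] := flat_reduce flJ ind.
    have := leq_trans sr (rmax _ _ _ fG' (subset_trans GJ JG')).
    by rewrite addn1 ltnn.
  move=> nind.
  have [c [Mc c0]] : exists c, join_norm rho1 rho2 (c *m B) = 0 /\ c <> 0.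
    apply: contrapT => H; apply: nind; split=> [i|c Mc].
      case: (split_ordP i) => l ->.
        have [p lp] := fr l; exists p, p, p.
        by rewrite rowKu row_row_mx row_mxKl row_mxKr !row1 mixxx.
      have [p jp] := fr j; exists (mix d p x), p, x.
      by rewrite rowKd row_row_mx row_mxKl row_mxKr row0 (_ : row l _ = delta_mx 0 j)//;
         apply/rowP => i'; rewrite mxE ord1.
    by apply: contrapT => c0; apply: H; exists c.
  rewrite -[c]hsubmxK mul_row_col !mul_mx_row !mulmx1 mulmx0 add_row_mx addr0 in Mc.
  set e := lsubmx c in Mc; set b := rsubmx c in Mc.
  move: Mc; rewrite [b]mx11_scalar mul_scalar_mx /join_norm row_mxKl row_mxKr => /eqP.
  rewrite sqrtr_eq0 => Mc.
  have : rho1 (e + b 0 0 *: delta_mx 0 j) ^+ 2 + rho2 e ^+ 2 == 0.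
    by rewrite eq_le Mc addr_ge0// sqr_ge0.
  rewrite paddr_eq0 ?sqr_ge0// !sqrf_eq0 => /andP[/eqP M1 /eqP M2].
  have b0 : b 0 0 != 0.
    apply/eqP => b0; apply: c0; rewrite b0 scale0r addr0 in M1.
    have e0 : e = 0.
      apply: N0; apply/eqP; rewrite -sqrf_eq0; apply/eqP.
      by rewrite pyth M1 M2 expr0n addr0.
    by rewrite -[c]hsubmxK -/e -/b e0 [b]mx11_scalar b0 raddf0 row_mx0.
  exists (- (b 0 0)^-1 *: e); split; last by rewrite (seminormZ s2) M2 mulr0.
  rewrite (_ : _ - _ = (b 0 0)^-1 *: (e + b 0 0 *: delta_mx 0 j)); last first.
    by rewrite scalerDr scalerA mulVf// scale1r scaleNr opprK addrC.
  by rewrite (seminormZ s1) M1 mulr0.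
pose A := \matrix_(i, j) a i 0 j.
have rowA i : row i A = a i by apply/rowP => j; rewrite !mxE.
have A2 w : rho2 (w *m A) = 0.
  rewrite mulmx_sum_row; apply: (seminorm_sum0 s2) => i.
  by rewrite rowA (seminormZ s2) (aP i).2 mulr0.
have A1 w : rho1 (w *m (1%:M - A)) = 0.
  rewrite mulmx_sum_row; apply: (seminorm_sum0 s1) => i.
  by rewrite linearB/= row1 rowA (seminormZ s1) (aP i).1 mulr0.
have NA w : N (w *m A) = rho1 w.
  apply/eqP; rewrite -(eqrXn2 (n := 2))// ?(seminorm_ge0 sN) ?(seminorm_ge0 s1)//.
  rewrite pyth A2 expr0n addr0 eqf_sqr; apply/orP; left; apply/eqP.
  rewrite -[RHS](seminorm_add0 s1 _ (_ : rho1 (- (w *m (1%:M - A))) = 0)).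
    by congr rho1; rewrite mulmx1B opprB addrC subrK.
  by rewrite (seminormN s1).
have NA' w : N (w *m (1%:M - A)) = rho2 w.
  apply/eqP; rewrite -(eqrXn2 (n := 2))// ?(seminorm_ge0 sN) ?(seminorm_ge0 s2)//.
  rewrite pyth A1 expr0n add0r eqf_sqr; apply/orP; left; apply/eqP.
  rewrite mulmx1B -[LHS](seminorm_add0 s2 _ (A2 w)).
  by rewrite subrK.
exists A; split=> [|w|u v p q up vq|u v p q up vq].
- apply: mulmx_ext => w; apply/eqP; rewrite -subr_eq0; apply/eqP.
  apply: N0; rewrite mulmxA -mulmxBl NA -opprB (seminormN s1) -mulmx1B.
  exact: A1.
- by rewrite NA NA' pyth.
- by rewrite NA (E1 _ _ _ _ up vq).
- by rewrite NA' -(E2 _ _ _ _ up vq).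
Qed.

(** The splitting expresses distances between mixed points by the same [N], so the product of the
    two projections is a flat in the same coordinates. *)
Lemma mix_closure {r} (d : decomposition X) (N : 'rV[R]_r -> R) G A :
  framed_flat x N G -> splitting d N G A ->
  exists2 G1, framed_flat x N G1 & G `<=` G1 /\
    forall u v p q, G (u, p) -> G (v, q) -> G1 (u *m A + v *m (1%:M - A), mix d p q).
Proof.
move=> [[sN iso conv Gx] N0 fr] [AA pyth E1 E2].
pose G1 : set ('rV[R]_r * X) := [set z | exists u v p q,
  [/\ G (u, p), G (v, q), z.1 = u *m A + v *m (1%:M - A) & z.2 = mix d p q]].
have GG1 : G `<=` G1.
  move=> [u p] up; exists u, u, p, p; split=> //=; last by rewrite mixxx.
  by rewrite mulmx1B addrC subrK.
exists G1; last first.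
  by split=> // u v p q up vq; exists u, v, p, q.
split=> //; last by move=> i; have [p ip] := fr i; exists p; exact: GG1.
split=> //; last exact: GG1.
- move=> w w' s s' [u [v [p [q [up vq /= wE sE]]]]] [u' [v' [p' [q' [up' vq' /= wE' sE']]]]].
  rewrite wE sE wE' sE'.
  apply/eqP; rewrite -(eqrXn2 (n := 2)) ?mdist_ge0 ?(seminorm_ge0 sN)//; apply/eqP.
  rewrite mdist_mix (E1 _ _ _ _ up up') (E2 _ _ _ _ vq vq') [RHS]pyth.
  have A1 : A *m (1%:M - A) = 0 by rewrite mulmxBr mulmx1 AA subrr.
  have A2 : (1%:M - A) *m A = 0 by rewrite mulmxBl mul1mx AA subrr.
  have A3 : (1%:M - A) *m (1%:M - A) = 1%:M - A.
    by rewrite [LHS]mulmxBr mulmx1 A2 subr0.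
  by rewrite !mulmxBl !mulmxDl -!mulmxA A1 A2 A3 AA !mulmx0 !addr0 !add0r.
- move=> w w' s s' t [u [v [p [q [up vq /= wE sE]]]]] [u' [v' [p' [q' [up' vq' /= wE' sE']]]]] t01.
  have [m um] := conv _ _ _ _ _ up up' t01; have [m' um'] := conv _ _ _ _ _ vq vq' t01.
  rewrite wE wE'.
  exists (mix d m m'), (u + t *: (u' - u)), (v + t *: (v' - v)), m, m'; split=> //=.
  rewrite !mulmxDl -!scalemxAl !mulmxBl.
  by move: (u *m A) (u' *m A) (v *m _) (v' *m _) => *; row_ring.
Qed.

Lemma maximal_graph {r} (N : 'rV[R]_r -> R) G : framed_flat x N G ->
  exists Gm, [/\ framed_flat x N Gm, G `<=` Gm &
    forall G', framed_flat x N G' -> Gm `<=` G' -> G' `<=` Gm].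
Proof.
(* The union with [G] makes the empty chain admissible in Zorn's lemma. *)
move=> fG; pose P A := framed_flat x N (A `|` G).
have [F FP tot|A [PA Amax]] := @Zorn_bigcup _ P.
  set U := \bigcup_(A in F) A `|` G.
  have common z1 z2 : U z1 -> U z2 -> exists H, [/\ framed_flat x N H, H `<=` U, H z1 & H z2].
    have FU A : F A -> A `|` G `<=` U.
      by move=> FA z [Az|Gz]; [left; exists A|right].
    move=> [[A FA Az1]|Gz1] [[B FB Bz2]|Gz2].
    - have [AB|BA] := tot A B FA FB.
        by exists (B `|` G); split; [exact: FP|exact: FU|left; exact: AB|left].
      by exists (A `|` G); split; [exact: FP|exact: FU|left|left; exact: BA].
    - by exists (A `|` G); split; [exact: FP|exact: FU|left|right].
    - by exists (B `|` G); split; [exact: FP|exact: FU|right|left].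
    - by exists G; split=> // z; right.
  have [[sN iso conv Gx] N0 fr] := fG.
  split; [split=> // [u v p q up vq|u v p q t up vq t01|]|by []|].
  - by have [H [[[_ isoH _ _] _ _] _ up' vq']] := common _ _ up vq; exact: isoH up' vq'.
  - have [H [[[_ _ convH _] _ _] HU up' vq']] := common _ _ up vq.
    by have [m um] := convH _ _ _ _ _ up' vq' t01; exists m; exact: HU.
  - by right.
  - by move=> i; have [p ip] := fr i; exists p; right.
exists (A `|` G); split=> // G' fG' AG' z G'z; apply: contrapT => nz.
apply: (Amax G').
  by split=> [y Ay|G'A]; [apply: AG'; left|apply: nz; left; exact: G'A].
rewrite /P (_ : G' `|` G = G')//; apply/seteqP; split=> [y [//|Gy]|y G'y]; last by left.
by apply: AG'; right.
Qed.

(** Two maximizations: maximal dimension provides the splittings, then a maximal graph for that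
    dimension and norm equals its own [mix_closure]. This works for both decompositions at once,
    without alternating between them. *)
Lemma saturated_flat (d d' : decomposition X) n0 {k} (M : 'rV[R]_k -> R) G0 :
  (forall r (N : 'rV[R]_r -> R) G, framed_flat x N G -> (r <= n0)%N) ->
  flat x M G0 ->
  exists r (N : 'rV[R]_r -> R) G A B, [/\ framed_flat x N G, points G0 `<=` points G,
    splitting d N G A /\ mix_closed d G A & splitting d' N G B /\ mix_closed d' G B].
Proof.
move=> bound fl0.
pose P r := `[< exists (N : 'rV[R]_r -> R) G, framed_flat x N G /\ points G0 `<=` points G >].
have exP : exists r, P r.
  have [|r [N [G [_ fG G0G]]]] := @flat_reduce _ _ x k 0 M G0 0 fl0.
    by split=> [[]//|c _]; rewrite [c]thinmx0.
  by exists r; apply/asboolP; exists N, G.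
have leP r : P r -> (r <= n0)%N by move=> /asboolP[N [G [fG _]]]; exact: bound fG.
case: (ex_maxnP exP leP) => r /asboolP[N [G [fG G0G]]] rmax.
have [Gm [fGm GGm Gmmax]] := maximal_graph fG.
have G0Gm : points G0 `<=` points Gm.
  by move=> p /G0G[z Gz <-]; exists z => //; exact: GGm.
have split_closed e : exists A, splitting e N Gm A /\ mix_closed e Gm A.
  have [|A sA] := maximal_splitting e fGm.
    move=> r' N' G' fG' GmG'; apply: rmax; apply/asboolP; exists N', G'; split=> //.
    exact: subset_trans G0Gm GmG'.
  exists A; split=> // u v p q up vq.
  have [G1 fG1 [GmG1 G1P]] := mix_closure fGm sA.
  by apply: (Gmmax G1) => //; exact: G1P.
have [A [sA cA]] := split_closed d; have [B [sB cB]] := split_closed d'.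
by exists r, N, Gm, A, B.
Qed.

End saturation.

(** * Transversal decompositions of a vector space *)

(* Products are abstracted up to conversion, since [mulNmx] changes the ring
   structure inferred for them. *)
Ltac row_linear :=
  rewrite !(mulmx1B, mulmxDl, mulNmx);
  repeat match goal with |- context [@mulmx ?S ?a ?b ?c ?u ?M] =>
    let y := fresh "y" in set y := (@mulmx S a b c u M); move: (y) => {y} ? end;
  row_ring.

Section transversal_linear.
Context {R : realType} {r : nat}.
Implicit Types (D : set 'rV[R]_r) (A B : 'M[R]_r) (u v w : 'rV[R]_r).

Definition mix_stable D A :=
  forall u v, D u -> D v -> D (u *m A + v *m (1%:M - A)).

Definition transversal_on D A B := forall u, D u ->
  [/\ u *m A = u -> u *m B = u -> u = 0, u *m A = u -> u *m B = 0 -> u = 0,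
      u *m A = 0 -> u *m B = u -> u = 0 & u *m A = 0 -> u *m B = 0 -> u = 0].

(** The leftmost factor acts first: [A *m B *m (1%:M - A)] carries the first factor to the second,
    and [B *m A] brings the result back as a displacement of the kind found in [translate]. *)
Definition zigzag A B := A *m B *m (1%:M - A) *m B *m A.

Lemma idem_compl A : A *m A = A -> (1%:M - A) *m (1%:M - A) = 1%:M - A.
Proof. by move=> AA; rewrite mulmxBr mulmx1 mulmxBl mul1mx AA subrr subr0. Qed.

Lemma idem_mulr0 A : A *m A = A -> (1%:M - A) *m A = 0.
Proof. by move=> AA; rewrite mulmxBl mul1mx AA subrr. Qed.

Lemma mix_stable_compl D A : mix_stable D A -> mix_stable D (1%:M - A).
Proof.
move=> DA u v Du Dv; have -> : 1%:M - (1%:M - A) = A by rewrite opprB addrC subrK.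
by rewrite addrC; exact: DA.
Qed.

Lemma transversal_compl D A B : transversal_on D A B -> transversal_on D (1%:M - A) B.
Proof.
have E1 u : u *m (1%:M - A) = u -> u *m A = 0.
  by rewrite mulmx1B => /eqP; rewrite -subr_eq0 addrAC subrr add0r oppr_eq0 => /eqP.
have E2 u : u *m (1%:M - A) = 0 -> u *m A = u.
  by rewrite mulmx1B => /eqP; rewrite subr_eq0 => /eqP.
move=> tr u Du; have [t1 t2 t3 t4] := tr u Du; split=> [/E1|/E1|/E2|/E2] //.
Qed.

(** [T] and its square have equal kernels, hence equal ranks, hence equal ranges. *)
Lemma mulmx_square_range (T : 'M[R]_r) :
  (forall v, v *m T *m T = 0 -> v *m T = 0) -> forall u, exists v, u *m T = v *m T *m T.
Proof.
move=> T0 u; suff /submxP[V VE] : (T <= T *m T)%MS.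
  by exists (u *m V); rewrite {1}VE !mulmxA.
have TT : (T *m T <= T)%MS by exact: submxMl.
have [_ <-] := mxrank_leqif_sup TT; rewrite eqn_leq mxrankS//=.
have K : (kermx (T *m T) <= kermx T)%MS.
  apply/row_subP => i; apply/sub_kermxP; apply: T0.
  by rewrite -mulmxA -row_mul mulmx_ker row0.
have := mxrankS K; rewrite !mxrank_ker.
by rewrite leq_sub2lE// ?rank_leq_row.
Qed.

Section half.
Variables (D : set 'rV[R]_r) (A B : 'M[R]_r).
Hypotheses (Dconv : convex_dom D) (D0 : D 0) (De : forall i, D (delta_mx 0 i)).
Hypotheses (AA : A *m A = A) (BB : B *m B = B).
Hypotheses (DA : mix_stable D A) (DB : mix_stable D B) (tr : transversal_on D A B).

Let proj1 C u : mix_stable D C -> D u -> D (u *m C).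
Proof. by move=> DC Du; have := DC u 0 Du D0; rewrite mul0mx addr0. Qed.

Let proj2 C u : mix_stable D C -> D u -> D (u *m (1%:M - C)).
Proof. by move=> DC Du; have := DC 0 u D0 Du; rewrite mul0mx add0r. Qed.

(* With [v = u + w], recombining the coordinates of [u] and [v] in the second
   decomposition and projecting back translates [u] by a multiple of [w B A]. *)
Let translate u w : D u -> u *m A = u -> D w -> w *m A = 0 ->
  D (u + w *m B *m A) /\ D (u - w *m B *m A).
Proof.
move=> Du uA Dw wA.
have Dv : D (u + w).
  by have := DA Du Dw; rewrite uA mulmx1B wA subr0.
have D1 := proj1 DA (DB Du Dv); have D2 := proj1 DA (DB Dv Du).
split.
  suff <- : ((u + w) *m B + u *m (1%:M - B)) *m A = u + w *m B *m A by [].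
  by rewrite -[X in _ = X + _]uA; row_linear.
suff <- : (u *m B + (u + w) *m (1%:M - B)) *m A = u - w *m B *m A by [].
rewrite -[X in _ = X - _]uA -[RHS]addr0 -wA; row_linear.
Qed.

(** Directions of whole lines along which the first factor of [D] is invariant. They form a subspace
    although [D] is only convex. *)
Let tangent h := h *m A = h /\ forall u, D u -> u *m A = u -> forall t, D (u + t *: h).

Let tangentD h k : tangent h -> tangent k -> tangent (h + k).
Proof.
move=> [hA Hh] [kA Hk]; split=> [|u Du uA t]; first by rewrite mulmxDl hA kA.
rewrite scalerDr addrA; apply: Hk; first exact: Hh.
by rewrite mulmxDl -scalemxAl hA uA.
Qed.

Let tangentZ c h : tangent h -> tangent (c *: h).
Proof.
move=> [hA Hh]; split=> [|u Du uA t]; first by rewrite -scalemxAl hA.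
by rewrite scalerA; exact: Hh.
Qed.

Let tangent_sum (M : 'M[R]_r) u : (forall i, tangent (row i M)) -> tangent (u *m M).
Proof.
move=> H; rewrite mulmx_sum_row; apply: (big_ind tangent).
- by split=> [|v Dv _ t]; rewrite ?mul0mx// scaler0 addr0.
- exact: tangentD.
- by move=> i _; exact: tangentZ.
Qed.

Let tangent_translate w : D w -> w *m A = 0 -> tangent (w *m B *m A).
Proof.
move=> Dw wA; set h := w *m B *m A.
have hA : h *m A = h by rewrite /h -mulmxA AA.
(* Iterating [translate] in either sense gives the integer multiples; convexity then fills in the
   real ones. *)
have step e u (n : nat) : (e = 1 \/ e = -1) -> D u -> u *m A = u -> D (u + (e * n%:R) *: h).
  move=> e1 Du uA; elim: n => [|n IH]; first by rewrite mulr0 scale0r addr0.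
  have [|T1 T2] := translate IH _ Dw wA; first by rewrite mulmxDl -scalemxAl hA uA.
  rewrite -natr1 mulrDr mulr1 scalerDl addrA.
  by case: e1 T1 T2 => -> T1 T2; rewrite ?scale1r ?scaleN1r.
split=> // u Du uA t.
pose n := (Num.bound `|t|).+1.
have tn : `|t| <= n%:R.
  by rewrite ltW// (lt_trans (archi_boundP (normr_ge0 t)))// ltr_nat.
have [e [e1 et]] : exists e, (e = 1 \/ e = -1) /\ t = e * `|t|.
  have [t0|t0] := leP 0 t; first by exists 1; split; [left|rewrite ger0_norm// mul1r].
  by exists (-1); split; [right|rewrite ltr0_norm// mulN1r opprK].
have -> : u + t *: h = u + (`|t| / n%:R) *: ((u + (e * n%:R) *: h) - u).
  rewrite {1}et addrAC subrr add0r scalerA; congr (_ + _ *: _).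
  by field; rewrite pnatr_eq0.
apply: Dconv => //; first exact: step.
by rewrite divr_ge0//= ler_pdivrMr ?ltr0n// mul1r.
Qed.

Let zigzag_tangent u : tangent (u *m zigzag A B).
Proof.
apply: tangent_sum => i; rewrite rowE /zigzag !mulmxA.
apply: tangent_translate; last by rewrite -mulmxA idem_mulr0// mulmx0.
exact: (proj2 DA (proj1 DB (proj1 DA (De i)))).
Qed.

Let zigzagA u : u *m zigzag A B *m A = u *m zigzag A B.
Proof. by rewrite /zigzag -!mulmxA AA. Qed.

(** Each of the four transversality conditions undoes one step: in turn [w *m B], [w], [u *m B] and
    [u] vanish. *)
Let zigzag_inj u : D u -> u *m A = u -> u *m zigzag A B = 0 -> u = 0.
Proof.
move=> Du uA; rewrite /zigzag !mulmxA uA => z0.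
have DuB := proj1 DB Du; set w := u *m B *m (1%:M - A) in z0.
have Dw : D w by exact: proj2.
have wA : w *m A = 0 by rewrite /w -mulmxA idem_mulr0// mulmx0.
have wB : w *m B = 0.
  have [_ _ t3 _] := tr (proj1 DB Dw); apply: t3 => //; by rewrite -mulmxA BB.
have w0 : w = 0 by have [_ _ _ t4] := tr Dw; exact: t4.
have uBA : u *m B *m A = u *m B.
  by apply/eqP; rewrite eq_sym -subr_eq0 -mulmx1B -/w w0.
have uB : u *m B = 0.
  have [t1 _ _ _] := tr DuB; apply: t1 => //; by rewrite -mulmxA BB.
by have [_ t2 _ _] := tr Du; exact: t2.
Qed.

Let zigzag_dom u : D (u *m zigzag A B).
Proof.
have [_ H] := zigzag_tangent u; have := H 0 D0 (mul0mx _ _) 1.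
by rewrite scale1r add0r.
Qed.

Let zigzag_range u : exists v, u *m zigzag A B = v *m zigzag A B *m zigzag A B.
Proof.
apply: mulmx_square_range => v; apply: zigzag_inj; first exact: zigzag_dom.
exact: zigzagA.
Qed.

(** [u] and [v *m zigzag A B] have the same image under [zigzag A B]. Their difference stays in [D]
    because the subtracted vector is tangent, so injectivity applies to it. *)
Let zigzag_fix u : D u -> u *m A = u -> exists v, u = v *m zigzag A B.
Proof.
move=> Du uA; have [v vE] := zigzag_range u; exists v.
apply/eqP; rewrite -subr_eq0; apply/eqP; apply: zigzag_inj.
- have [_ H] := zigzag_tangent v; have := H u Du uA (-1).
  by rewrite scaleN1r.
- by rewrite mulmxBl uA zigzagA.
- by rewrite mulmxBl vE subrr.
Qed.

Lemma zigzag_onto u : exists v, u *m A = v *m zigzag A B.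
Proof.
have /choice[f fP] (i : 'I_r) : exists v, delta_mx 0 i *m A = v *m zigzag A B.
  by apply: zigzag_fix; [exact: proj1 | rewrite -mulmxA AA].
pose F := \matrix_i f i; exists (u *m F).
rewrite -mulmxA; congr (_ *m _); apply/row_matrixP => i.
by rewrite row_mul rowK -fP rowE.
Qed.

Lemma range_dom u : D (u *m A).
Proof. by have [v ->] := zigzag_onto u; exact: zigzag_dom. Qed.

End half.

Section whole.
Variables (D : set 'rV[R]_r) (A B : 'M[R]_r).
Hypotheses (Dconv : convex_dom D) (D0 : D 0) (De : forall i, D (delta_mx 0 i)).
Hypotheses (AA : A *m A = A) (BB : B *m B = B).
Hypotheses (DA : mix_stable D A) (DB : mix_stable D B) (tr : transversal_on D A B).

Lemma zigzag_onto_compl u : exists v, u *m (1%:M - A) = v *m zigzag (1%:M - A) B.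
Proof.
exact: (zigzag_onto Dconv D0 De (idem_compl AA) BB (mix_stable_compl DA) DB (transversal_compl tr)).
Qed.

Lemma transversal_domT u : D u.
Proof.
have D1 := range_dom Dconv D0 De AA BB DA DB tr u.
have D2 := range_dom Dconv D0 De (idem_compl AA) BB (mix_stable_compl DA) DB (transversal_compl tr) u.
have := DA D1 D2; rewrite -!mulmxA AA idem_compl// mulmx1B addrC subrK.
by [].
Qed.

(** [zigzag A B] factors through [1%:M - A] and covers the range of [A], so the rank of [A] is at
    most that of its complement; by symmetry both are half of [r]. *)
Lemma zigzag_rank : r = (2 * \rank A)%N.
Proof.
have AT : (A <= zigzag A B)%MS.
  apply/row_subP => i; rewrite rowE.
  by have [v ->] := zigzag_onto Dconv D0 De AA BB DA DB tr (delta_mx 0 i); exact: submxMl.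
have CT : (1%:M - A <= zigzag (1%:M - A) B)%MS.
  apply/row_subP => i; rewrite rowE.
  by have [v ->] := zigzag_onto_compl (delta_mx 0 i); exact: submxMl.
have E : \rank A = \rank (1%:M - A).
  apply/eqP; rewrite eqn_leq; apply/andP; split.
    apply: leq_trans (mxrankS AT) _; rewrite /zigzag -!mulmxA.
    by rewrite !mulmxA -mulmxA; apply: leq_trans (mxrankM_maxl _ _) (mxrankM_maxr _ _).
  apply: leq_trans (mxrankS CT) _; rewrite /zigzag opprB addrC [1%:M + _]addrC subrK.
  by rewrite -mulmxA; apply: leq_trans (mxrankM_maxl _ _) (mxrankM_maxr _ _).
have le : (r <= \rank A + \rank (1%:M - A)%R)%N.
  have := @mxrank_add R r r A (1%:M - A).
  by rewrite [A + _]addrC subrK mxrank1.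
have ge : (\rank A + \rank (1%:M - A)%R <= r)%N.
  by apply: mulmx0_rank_max; rewrite mulmxBr mulmx1 AA subrr.
by apply/eqP; rewrite eqn_leq mul2n -addnn [X in (_ + X)%N]E le ge.
Qed.

End whole.
End transversal_linear.

(** * The parallelogram law and Euclidean coordinates *)

Section parallelogram_law.
Context {R : realType} {r : nat} (N : 'rV[R]_r -> R).
Hypothesis sN : is_seminorm N.
Let f u := N u ^+ 2.

Let f0 : f 0 = 0. Proof. by rewrite /f (seminorm0 sN) expr0n. Qed.
Let fZ t u : f (t *: u) = t ^+ 2 * f u.
Proof. by rewrite /f (seminormZ sN) exprMn real_normK// num_real. Qed.

(* Second differences of [f] in a direction of each factor of the second
   decomposition vanish; read off in the first decomposition, this makes the
   second differences of [f] on a factor constant. *)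
Lemma parallelogram_factor (A B : 'M[R]_r) :
  A *m A = A -> B *m B = B ->
  (forall w : 'rV[R]_r, N w ^+ 2 = N (w *m A) ^+ 2 + N (w *m (1%:M - A)) ^+ 2) ->
  (forall w : 'rV[R]_r, N w ^+ 2 = N (w *m B) ^+ 2 + N (w *m (1%:M - B)) ^+ 2) ->
  (forall u : 'rV[R]_r, exists v : 'rV[R]_r, u *m A = v *m zigzag A B) ->
  forall a p : 'rV[R]_r, a *m A = a -> p *m A = p ->
    N (a + p) ^+ 2 + N (a - p) ^+ 2 = 2 * (N a ^+ 2 + N p ^+ 2).
Proof.
move=> AA BB fA fB onto a p aA pA.
have [v] := onto p; rewrite pA /zigzag !mulmxA => pE.
set w := v *m A *m B *m (1%:M - A) in pE.
have wA : w *m A = 0 by rewrite /w -mulmxA idem_mulr0// mulmx0.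
(* [t] and [- s] are the parts of [w] in the two factors of the second decomposition. As [w *m A]
   vanishes, [t] and [s] share the component [p]. *)
pose t := w *m B; pose s := - (w *m (1%:M - B)).
have tA : t *m A = p by [].
have sA : s *m A = p by rewrite /s mulmx1B mulNmx mulmxBl wA -pE sub0r opprK.
have tB : t *m B = t by rewrite /t -mulmxA BB.
have sB : s *m B = 0 by rewrite /s mulNmx -mulmxA idem_mulr0// mulmx0 oppr0.
have D2 y : f (y + s + t) - f (y + s) - f (y + t) + f y = 0.
  rewrite /f fB (fB (y + s)) (fB (y + t)) (fB y) !mulmx1B !mulmxDl tB sB !addr0.
  rewrite (_ : y + s + t - (y *m B + t) = y + s - y *m B); last first.
    by move: (y *m B) => *; row_ring.
  rewrite (_ : y + t - (y *m B + t) = y - y *m B); last first.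
    by move: (y *m B) => *; row_ring.
  by ring.
have D3 y : y *m A = y -> f (y + p + p) - 2 * f (y + p) + f y = 2 * f p.
  have H y' : y' *m A = y' -> f (y' + p + p) - 2 * f (y' + p) + f y' =
      f (s *m (1%:M - A)) + f (t *m (1%:M - A)) - f ((s + t) *m (1%:M - A)).
    move=> yA; have := D2 y'; rewrite /f fA (fA (y' + s)) (fA (y' + t)).
    rewrite !mulmxDl sA tA yA [y' *m (1%:M - A)]mulmx1B yA subrr !add0r.
    by lra.
  move=> yA; rewrite H// -(H 0) ?mul0mx// !add0r f0.
  by rewrite -mulr2n -scaler_nat fZ; ring.
have apA : (a - p) *m A = a - p by rewrite mulmxBl aA pA.
by have := D3 (a - p) apA; rewrite subrK /f; lra.
Qed.

Lemma parallelogram_law (A B : 'M[R]_r) :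
  A *m A = A -> B *m B = B ->
  (forall w : 'rV[R]_r, N w ^+ 2 = N (w *m A) ^+ 2 + N (w *m (1%:M - A)) ^+ 2) ->
  (forall w : 'rV[R]_r, N w ^+ 2 = N (w *m B) ^+ 2 + N (w *m (1%:M - B)) ^+ 2) ->
  (forall u : 'rV[R]_r, exists v : 'rV[R]_r, u *m A = v *m zigzag A B) ->
  (forall u : 'rV[R]_r, exists v : 'rV[R]_r, u *m (1%:M - A) = v *m zigzag (1%:M - A) B) ->
  forall u v, N (u + v) ^+ 2 + N (u - v) ^+ 2 = 2 * (N u ^+ 2 + N v ^+ 2).
Proof.
move=> AA BB fA fB onto onto' u v.
have CC : 1%:M - (1%:M - A) = A by rewrite opprB addrC subrK.
have idA (w : 'rV[R]_r) : w *m A *m A = w *m A by rewrite -mulmxA AA.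
have idA' (w : 'rV[R]_r) : w *m (1%:M - A) *m (1%:M - A) = w *m (1%:M - A).
  by rewrite -mulmxA idem_compl.
have P1 := parallelogram_factor AA BB fA fB onto (idA u) (idA v).
have fA' (w : 'rV[R]_r) : N w ^+ 2 = N (w *m (1%:M - A)) ^+ 2 + N (w *m (1%:M - (1%:M - A))) ^+ 2.
  by rewrite CC addrC.
have P2 := parallelogram_factor (idem_compl AA) BB fA' fB onto' (idA' u) (idA' v).
rewrite fA (fA (u - v)) (fA u) (fA v) !mulmxDl !mulNmx.
by move: P1 P2; lra.
Qed.

End parallelogram_law.

Section jordan_von_neumann.
Context {R : realType} {r : nat} (N : 'rV[R]_r -> R).
Hypothesis hN : is_norm N.
Hypothesis par : forall u v, N (u + v) ^+ 2 + N (u - v) ^+ 2 = 2 * (N u ^+ 2 + N v ^+ 2).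
Implicit Types u v w : 'rV[R]_r.

Let sN := hN.1.

Definition polar u v : R := (N (u + v) ^+ 2 - N (u - v) ^+ 2) / 4.

Lemma polarC u v : polar u v = polar v u.
Proof. by rewrite /polar [u + v]addrC [N (u - v)](seminormBC sN). Qed.

Lemma polarxx u : polar u u = N u ^+ 2.
Proof.
rewrite /polar subrr (seminorm0 sN) expr0n subr0 -mulr2n -scaler_nat (seminormZ sN).
by rewrite exprMn normr_nat; field.
Qed.

Lemma polarDl u v w : polar (u + v) w = polar u w + polar v w.
Proof.
have := par (u + w) v; have := par (u - w) v; have := par (v + w) u; have := par (v - w) u.
rewrite [N (v - w - u)](_ : _ = N (u + w - v)); last first.
  by rewrite -(seminormN sN); congr N; row_ring.
rewrite [N (v + w - u)](_ : _ = N (u - w - v)); last first.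
  by rewrite -(seminormN sN); congr N; row_ring.
rewrite [v + w + u](_ : _ = u + v + w); last by row_ring.
rewrite [v - w + u](_ : _ = u + v - w); last by row_ring.
rewrite [u + w + v](_ : _ = u + v + w); last by row_ring.
rewrite [u - w + v](_ : _ = u + v - w); last by row_ring.
by rewrite /polar; lra.
Qed.

Lemma polar_le u v : `|polar u v| <= 2 * N u * N v.
Proof.
have u0 := seminorm_ge0 sN u; have v0 := seminorm_ge0 sN v.
have H a b : N (a + b) ^+ 2 - N (a - b) ^+ 2 <= 8 * (N a * N b).
  have := par a b; have := seminormD sN a b.
  have a0 := seminorm_ge0 sN a; have b0 := seminorm_ge0 sN b.
  have ab0 := seminorm_ge0 sN (a + b).
  by nra.
have Hp := H u v; have Hm := H u (- v); rewrite opprK (seminormN sN) in Hm.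
by rewrite /polar ler_norml; apply/andP; split; lra.
Qed.

(** The defect [a] of homogeneity is additive, vanishes at natural numbers and is bounded on
    [[0, 1]], hence bounded on all nonnegative reals; such an additive function is zero. *)
Lemma polarZl t u v : polar (t *: u) v = t * polar u v.
Proof.
pose a s := polar (s *: u) v - s * polar u v.
have aD s s' : a (s + s') = a s + a s'.
  by rewrite /a scalerDl polarDl; ring.
have a0 : a 0 = 0 by have := aD 0 0; rewrite addr0; lra.
have aMn (n : nat) s : a (n%:R * s) = n%:R * a s.
  elim: n => [|n IH]; first by rewrite !mul0r.
  by rewrite -[in LHS]natr1 -[in RHS]natr1 mulrDl mul1r aD IH; ring.
have a1 : a 1 = 0 by rewrite /a scale1r mul1r subrr.
have aN s : a (- s) = - a s by have := aD s (- s); rewrite subrr a0; lra.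
have anat (n : nat) : a n%:R = 0 by have := aMn n 1; rewrite mulr1 a1 mulr0.
have bound s : 0 <= s <= 1 -> `|a s| <= 4 * N u * N v.
  move=> /andP[s0 s1]; have u0 := seminorm_ge0 sN u; have v0 := seminorm_ge0 sN v.
  have := polar_le (s *: u) v; have := polar_le u v; rewrite (seminormZ sN). rewrite (ger0_norm s0).
  move=> p1 p2; rewrite /a (le_trans (ler_normB _ _))// [`|s * _|]normrM (ger0_norm s0).
  have : s * `|polar u v| <= 1 * (2 * N u * N v) by apply: ler_pM.
  have : s * (N u * N v) <= 1 * (N u * N v) by apply: ler_wpM2r => //; exact: mulr_ge0.
  by move: p1 p2; nra.
have bound' s : 0 <= s -> `|a s| <= 4 * N u * N v.
  move=> s0; have /andP[h1 h2] := truncn_itv s0.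
  rewrite -[s](subrK (Num.truncn s)%:R) aD anat addr0; apply: bound.
  by rewrite subr_ge0 h1 lerBlDr addrC natr1 ltW.
have aabs s : 0 <= s -> a s = 0.
  move=> s0; apply/eqP; rewrite -normr_eq0 eq_le normr_ge0 andbT leNgt; apply/negP => as0.
  pose K := 4 * N u * N v.
  have K0 : 0 <= K by rewrite !mulr_ge0// (seminorm_ge0 sN).
  pose n := (Num.bound (K / `|a s|)).
  have nK : K / `|a s| < n%:R by apply: archi_boundP; rewrite divr_ge0.
  rewrite ltr_pdivrMr// in nK.
  have := bound' (n%:R * s); rewrite mulr_ge0 ?ler0n// aMn normrM normr_nat => /(_ isT).
  by rewrite leNgt -/K nK.
suff : a t = 0 by rewrite /a => /eqP; rewrite subr_eq0 => /eqP.
have [t0|t0] := leP 0 t; first exact: aabs.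
by rewrite -[t]opprK aN aabs ?oppr0// oppr_ge0 ltW.
Qed.

Lemma polar0l v : polar 0 v = 0.
Proof. by rewrite -(scale0r 0) polarZl mul0r. Qed.

Lemma polar_suml (I : Type) (s : seq I) (F : I -> 'rV[R]_r) v :
  polar (\sum_(i <- s) F i) v = \sum_(i <- s) polar (F i) v.
Proof.
elim/big_rec2: _ => [|i y x _ <-]; first exact: polar0l.
by rewrite polarDl.
Qed.

Definition orthonormal_rows {m} (U : 'M[R]_(m, r)) :=
  forall i j, polar (row i U) (row j U) = (i == j)%:R.

Lemma orthonormal_coord {m} (U : 'M[R]_(m, r)) (c : 'rV[R]_m) j :
  orthonormal_rows U -> polar (c *m U) (row j U) = c 0 j.
Proof.
move=> oU; rewrite mulmx_sum_row polar_suml (bigD1 j)//= polarZl oU eqxx mulr1.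
by rewrite big1 ?addr0// => i ij; rewrite polarZl oU (negbTE ij) mulr0.
Qed.

Lemma orthonormal_row_free {m} (U : 'M[R]_(m, r)) : orthonormal_rows U -> row_free U.
Proof.
move=> oU; rewrite -kermx_eq0; apply/eqP/row_matrixP => i; rewrite row0.
apply/rowP => j; rewrite -(orthonormal_coord (row i (kermx U)) j oU).
by rewrite -row_mul mulmx_ker row0 polar0l mxE.
Qed.

Lemma orthonormal_extend {m} (U : 'M[R]_(m, r)) : orthonormal_rows U -> (m < r)%N ->
  exists U' : 'M[R]_(m + 1, r), orthonormal_rows U'.
Proof.
move=> oU mr.
have [v vU] : exists v : 'rV[R]_r, ~~ (v <= U)%MS.
  apply: contrapT => H; have : (1%:M <= U)%MS.
    apply/row_subP => i; apply: contrapT => /negP nU; apply: H.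
    by exists (row i 1%:M).
  by move=> /mxrankS; rewrite mxrank1 (eqP (orthonormal_row_free oU)) leqNgt mr.
pose c : 'rV[R]_m := \row_j polar v (row j U).
pose w := v - c *m U.
have w0 : w != 0.
  by apply: contra vU; rewrite subr_eq0 => /eqP ->; exact: submxMl.
have Nw : N w != 0 by apply: contra w0 => /eqP/hN.2 ->.
have polarBl a b e : polar (a - b) e = polar a e - polar b e.
  by rewrite polarDl -scaleN1r polarZl mulN1r.
have wU j : polar w (row j U) = 0.
  by rewrite polarBl (orthonormal_coord _ _ oU) mxE subrr.
pose n := (N w)^-1 *: w.
have nU j : polar n (row j U) = 0 by rewrite polarZl wU mulr0.
have nn : polar n n = 1.
  by rewrite polarZl polarC polarZl polarxx; field.
have rn (j : 'I_1) : row j n = n by apply/rowP => i; rewrite mxE ord1.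
exists (col_mx U n) => i j.
case: (split_ordP i) => i' ->; case: (split_ordP j) => j' ->; rewrite ?rowKu ?rowKd ?rn.
- by rewrite oU eq_lshift.
- by rewrite polarC nU eq_lrshift.
- by rewrite nU eq_rlshift.
- by rewrite nn !ord1 eqxx.
Qed.

Lemma orthonormal_basis :
  exists2 U : 'M[R]_r, U \in unitmx & forall c, N (c *m U) ^+ 2 = \sum_i c 0 i ^+ 2.
Proof.
have [U oU] : exists U : 'M[R]_r, orthonormal_rows U.
  suff H m : (m <= r)%N -> exists U : 'M[R]_(m, r), orthonormal_rows U by exact: H.
  elim: m => [_|m IH mr]; first by exists 0 => -[].
  have [U oU] := IH (ltnW mr); rewrite -addn1; exact: orthonormal_extend oU mr.
exists U; first by rewrite -row_free_unit orthonormal_row_free.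
move=> c; rewrite -polarxx {1}mulmx_sum_row polar_suml; apply: eq_bigr => i _.
by rewrite polarZl polarC (orthonormal_coord _ _ oU) expr2.
Qed.

End jordan_von_neumann.

Section euclidean_embedding.
Context {R : realType}.

Definition dot {n} (u v : 'rV[R]_n) : R := \sum_i u 0 i * v 0 i.

Lemma dotC n (u v : 'rV[R]_n) : dot u v = dot v u.
Proof. by apply: eq_bigr => i _; rewrite mulrC. Qed.

Lemma dot_subsqr n (u v : 'rV[R]_n) :
  dot (u - v) (u - v) = dot u u - 2 * dot u v + dot v v.
Proof.
rewrite /dot mulr_sumr -sumrB -big_split; apply: eq_bigr => i _ /=.
by rewrite !mxE; ring.
Qed.

Lemma dot_eq0 n (u : 'rV[R]_n) : dot u u = 0 -> u = 0.
Proof.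
move=> /eqP; rewrite psumr_eq0 => [/allP H|i _]; last by rewrite -expr2 sqr_ge0.
apply/rowP => i; rewrite mxE; have := H i (mem_index_enum i).
by rewrite /= mulf_eq0 orbb => /eqP.
Qed.

Lemma mdist_dot n (u v : euclidean R n) :
  mdist u v ^+ 2 = dot ((u : 'rV_n) - v) ((u : 'rV_n) - v).
Proof.
rewrite mdist_euclideanE sqr_sqrtr ?sum_sqr_ge0//.
by apply: eq_bigr => i _; rewrite !mxE expr2.
Qed.

Lemma dot_mulmx_tr m n (F : 'M[R]_(m, n)) (u : 'rV[R]_m) (w : 'rV[R]_n) :
  dot (u *m F) w = dot u (w *m F^T).
Proof.
have dotE k (a b : 'rV[R]_k) : dot a b = (a *m b^T) 0 0.
  by rewrite mxE; apply: eq_bigr => i _; rewrite mxE.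
by rewrite !dotE trmx_mul trmxK mulmxA.
Qed.

(** Once 0 is sent to 0, the map preserves [dot], so the images of the basis vectors are orthonormal
    and [n' = n]. Linearity comes last, from the vanishing length of [g u - u *m F]. *)
Lemma isometric_embedding_onto n n' (f : euclidean R n -> euclidean R n') :
  isometric_embedding f -> (n' <= n)%N -> forall w, exists u, f u = w.
Proof.
move=> fiso nn'; pose g (u : 'rV[R]_n) : 'rV[R]_n' := (f u : 'rV_n') - f 0.
have gsub u v : dot (g u - g v) (g u - g v) = dot (u - v) (u - v).
  have -> : g u - g v = (f u : 'rV_n') - f v by rewrite /g; row_ring.
  by rewrite -!mdist_dot fiso.
have g0 : g 0 = 0 by rewrite /g subrr.
have gg u : dot (g u) (g u) = dot u u by have := gsub u 0; rewrite g0 !subr0.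
have gdot u v : dot (g u) (g v) = dot u v.
  by have := gsub u v; rewrite (dot_subsqr (g u)) (dot_subsqr u) !gg; lra.
pose F : 'M[R]_(n, n') := \matrix_i g (delta_mx 0 i).
have dot_delta (u : 'rV[R]_n) i : dot u (delta_mx 0 i) = u 0 i.
  rewrite /dot (bigD1 i)//= mxE !eqxx mulr1 big1 ?addr0// => j ji.
  by rewrite mxE (negbTE ji) andbF mulr0.
have gF u : dot (g u) (u *m F) = dot u u.
  rewrite dotC dot_mulmx_tr; apply: eq_bigr => i _; congr (_ * _).
  rewrite mxE -[RHS]dot_delta -gdot; apply: eq_bigr => j _; congr (_ * _).
  by rewrite !mxE.
have FF : F *m F^T = 1%:M.
  apply/matrixP => i j; rewrite !mxE -[RHS](_ : dot (delta_mx 0 i) (delta_mx 0 j) = _).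
    by rewrite -gdot; apply: eq_bigr => k _; rewrite !mxE.
  by rewrite dot_delta mxE eqxx eq_sym.
have nE : n' = n.
  apply/eqP; rewrite eqn_leq nn' -{1}(mxrank1 R n) -FF.
  exact: leq_trans (mxrankM_maxl _ _) (rank_leq_col _).
subst n'; have FF' := mulmx1C FF => w.
pose u : 'rV[R]_n := ((w : 'rV_n) - f 0) *m F^T.
have uF : u *m F = (w : 'rV_n) - f 0 by rewrite /u -mulmxA FF' mulmx1.
exists u; have : g u = u *m F.
  apply/eqP; rewrite -subr_eq0; apply/eqP/dot_eq0.
  by rewrite (dot_subsqr (g u)) gg gF dot_mulmx_tr -mulmxA FF mulmx1; ring.
by rewrite uF => /addIr.
Qed.

End euclidean_embedding.

(** * Leaves through the base point, and the largest one *)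

Section leaves.
Context {R : realType} {X : metricType R} (d d' : decomposition X) (x : X).

Definition transversal := forall y,
  [/\ dist2 d x y = 0 -> dist2 d' x y = 0 -> y = x,
      dist2 d x y = 0 -> dist1 d' x y = 0 -> y = x,
      dist1 d x y = 0 -> dist2 d' x y = 0 -> y = x &
      dist1 d x y = 0 -> dist1 d' x y = 0 -> y = x].

Definition leaf (r : nat) (E : set X) :=
  exists (N : 'rV[R]_r -> R) G A B, [/\ framed_flat x N G, points G = E,
    splitting d N G A /\ mix_closed d G A & splitting d' N G B /\ mix_closed d' G B].

Hypothesis tr : transversal.

Section one_leaf.
Variables (r : nat) (N : 'rV[R]_r -> R) (G : set ('rV[R]_r * X)) (A B : 'M[R]_r).
Hypotheses (fG : framed_flat x N G) (sA : splitting d N G A) (cA : mix_closed d G A).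
Hypotheses (sB : splitting d' N G B) (cB : mix_closed d' G B).

Let D : set 'rV[R]_r := [set u | exists p, G (u, p)].

Let Dconv : convex_dom D.
Proof.
have [[_ _ conv _] _ _] := fG; move=> u v t [p up] [q vq] t01.
by have [m um] := conv _ _ _ _ _ up vq t01; exists m.
Qed.

Let D0 : D 0. Proof. by have [[_ _ _ ?] _ _] := fG; exists x. Qed.
Let De i : D (delta_mx 0 i). Proof. by have [_ _ fr] := fG; exact: fr. Qed.
Let AA : A *m A = A. Proof. by case: sA. Qed.
Let BB : B *m B = B. Proof. by case: sB. Qed.
Let DA : mix_stable D A.
Proof. by move=> u v [p up] [q vq]; exists (mix d p q); exact: cA. Qed.
Let DB : mix_stable D B.
Proof. by move=> u v [p up] [q vq]; exists (mix d' p q); exact: cB. Qed.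

Let trD : transversal_on D A B.
Proof.
have [[sN iso _ Gx] N0 _] := fG; have [_ _ A1 A2] := sA; have [_ _ B1 B2] := sB.
move=> u [p up].
have u0 : p = x -> u = 0.
  move=> px; apply: N0; rewrite -[u]subr0 -(iso _ _ _ _ up Gx) px.
  exact: mdistxx.
have H (C : 'M[R]_r) : u *m C = 0 -> N ((0 - u) *m C) = 0.
  by move=> uC; rewrite sub0r mulNmx uC oppr0 (seminorm0 sN).
have H' (C : 'M[R]_r) : u *m C = u -> N ((0 - u) *m (1%:M - C)) = 0.
  by move=> uC; apply: H; rewrite mulmx1B uC subrr.
have [t1 t2 t3 t4] := tr p.
by split=> /[dup] uA _ /[dup] uB _; apply: u0;
  [apply: t1|apply: t2|apply: t3|apply: t4];
  rewrite ?(A1 _ _ _ _ Gx up) ?(A2 _ _ _ _ Gx up) ?(B1 _ _ _ _ Gx up) ?(B2 _ _ _ _ Gx up);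
  rewrite ?(H A) ?(H B) ?(H' A) ?(H' B).
Qed.

Let DT u : exists p, G (u, p).
Proof. exact: (transversal_domT Dconv D0 De AA BB DA DB trD u). Qed.

Lemma leaf_euclidean_aux : exists m (phi : euclidean R (2 * m) -> X),
  [/\ r = (2 * m)%N, isometric_embedding phi & range phi = points G].
Proof.
have [[sN iso _ Gx] N0 _] := fG; have [_ pA _ _] := sA; have [_ pB _ _] := sB.
have par := parallelogram_law sN AA BB pA pB (zigzag_onto Dconv D0 De AA BB DA DB trD)
  (zigzag_onto_compl Dconv D0 De AA BB DA DB trD).
have [U Uu NU] := orthonormal_basis (conj sN N0) par.
have /choice[psi psiP] := DT.
have rE := zigzag_rank Dconv D0 De AA BB DA DB trD.
have [phi [phi_iso phiE]] : exists phi : euclidean R r -> X,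
    isometric_embedding phi /\ range phi = points G.
  exists (fun c => psi ((c : 'rV[R]_r) *m U)); split.
    move=> c c'; rewrite (iso _ _ _ _ (psiP _) (psiP _)) -mulmxBl.
    apply/eqP; rewrite -(eqrXn2 (n := 2)) ?mdist_ge0 ?(seminorm_ge0 sN)//; apply/eqP.
    by rewrite NU mdist_dot; apply: eq_bigr => i _; rewrite expr2.
  apply/seteqP; split=> [_ [c _ <-]|_ [[u p] up <-]].
    by exists ((c : 'rV[R]_r) *m U, psi ((c : 'rV[R]_r) *m U)).
  exists (u *m invmx U) => //=; rewrite mulmxKV//.
  have [fl _ _] := fG; exact: (flat_fun fl (psiP u) up).
by exists (\rank A); move: phi phi_iso phiE; rewrite -rE => phi phi_iso phiE; exists phi.
Qed.

(** [e1] and [e2] recover both coordinates of [e] from the first [d']-projection of the leaf, [e3]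
    and [e4] from the second. Their parameters [a], [b], [- a], [- b] come from zigzags; the sign
    changes because [a *m A] and [b *m (1%:M - A)] vanish. *)
Lemma leaf_zigzag_aux e : points G e -> exists e1 e2 e3 e4,
  [/\ [/\ points G e1, points G e2, points G e3 & points G e4],
    dist1 d (mix d' e1 x) e = 0, dist2 d (mix d' e2 x) e = 0,
    dist1 d (mix d' x e3) e = 0 & dist2 d (mix d' x e4) e = 0].
Proof.
have [[sN iso _ Gx] N0 _] := fG; have [_ pA A1 A2] := sA.
move=> [[u p] up /= <-] {e}.
have [v vE] := zigzag_onto Dconv D0 De AA BB DA DB trD u.
have [w wE] := zigzag_onto_compl Dconv D0 De AA BB DA DB trD u.
pose a := v *m A *m B *m (1%:M - A).
have aA : a *m A = 0 by rewrite /a -mulmxA idem_mulr0// mulmx0.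
have aBA : a *m B *m A = u *m A by rewrite vE /zigzag !mulmxA.
pose b := w *m (1%:M - A) *m B *m A.
have bA : b *m (1%:M - A) = 0 by rewrite mulmx1B /b -!mulmxA AA subrr.
have bBA : b *m B *m (1%:M - A) = u *m (1%:M - A).
  by rewrite wE /zigzag (_ : 1%:M - (1%:M - A) = A) ?mulmxA// opprB addrC subrK.
have [e1 ae1] := DT a; have [e2 be2] := DT b.
have [e3 ae3] := DT (- a); have [e4 be4] := DT (- b).
have pt z q : G (z, q) -> points G q by move=> zq; exists (z, q).
exists e1, e2, e3, e4; split; first by split; apply: pt; eassumption.
- rewrite (A1 _ _ _ _ (cB ae1 Gx) up) mul0mx addr0 mulmxBl aBA subrr.
  exact: seminorm0.
- rewrite (A2 _ _ _ _ (cB be2 Gx) up) mul0mx addr0 mulmxBl bBA subrr.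
  exact: seminorm0.
- rewrite (A1 _ _ _ _ (cB Gx ae3) up) mul0mx add0r mulmx1B !mulmxBl !mulNmx aA aBA.
  by rewrite oppr0 sub0r opprK subrr (seminorm0 sN).
- rewrite (A2 _ _ _ _ (cB Gx be4) up) mul0mx add0r mulmxBl (mulmx1B _ B) mulmxBl !mulNmx bA bBA.
  by rewrite oppr0 sub0r opprK subrr (seminorm0 sN).
Qed.

End one_leaf.

Lemma leaf_euclidean r E : leaf r E -> exists m (phi : euclidean R (2 * m) -> X),
  [/\ r = (2 * m)%N, isometric_embedding phi & range phi = E].
Proof.
move=> [N [G [A [B [fG <- [sA cA] [sB cB]]]]]].
exact: leaf_euclidean_aux fG sA cA sB cB.
Qed.

Lemma leaf_base r E : leaf r E -> E x.
Proof. by move=> [N [G [A [B [[[_ _ _ Gx] _ _] <- _ _]]]]]; exists (0, x). Qed.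

Lemma leaf_mix r E p q : leaf r E -> E p -> E q -> E (mix d p q).
Proof.
move=> [N [G [A [B [fG <- [sA cA] _]]]]] [[u p'] up /= <-] [[v q'] vq /= <-].
by exists (u *m A + v *m (1%:M - A), mix d p' q') => //; exact: cA.
Qed.

(* A leaf containing all the points [mix d' e e'] contains both leaves: a leaf
   is recovered from either of its projections in the second decomposition. *)
Lemma leaf_directed n0 r r' E E' :
  (forall r (N : 'rV[R]_r -> R) G, framed_flat x N G -> (r <= n0)%N) ->
  leaf r E -> leaf r' E' ->
  exists r'' E'', [/\ leaf r'' E'', E `<=` E'' & E' `<=` E''].
Proof.
move=> bound lE lE'.
have [N [G [A [B [fG GE [sA cA] [sB cB]]]]]] := lE.
have [N' [G' [A' [B' [fG' GE' [sA' cA'] [sB' cB']]]]]] := lE'.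
have [rho1 s1 E1] := dist1_seminorm fG d'.
have [rho2 s2 E2] := dist1_seminorm fG' (swap d').
have [flG _ _] := fG; have [flG' _ _] := fG'.
have flJ := join_flat flG flG' s1 s2 E1 E2.
have [r'' [N'' [G'' [A'' [B'' [fG'' JG'' h1 h2]]]]]] := saturated_flat d d' bound flJ.
have lE'' : leaf r'' (points G'') by exists N'', G'', A'', B''.
have J p q : E p -> E' q -> points G'' (mix d' p q).
  rewrite -GE -GE' => -[[u p'] up /= <-] [[v q'] vq /= <-]; apply: JG''.
  exists (row_mx u v, mix d' p' q') => //; exists p', q'.
  by rewrite /= row_mxKl row_mxKr.
have recover a b e : points G'' a -> points G'' b -> dist1 d a e = 0 -> dist2 d b e = 0 ->
    points G'' e.
  move=> Ga Gb ae be; have <- : mix d a b = e; last exact: leaf_mix lE'' Ga Gb.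
  apply: (@dist12_eq0 _ _ d).
    by rewrite (pseudometric_eql (dist1_pseudometric d) _ (dist1_mix d a b)).
  by rewrite (pseudometric_eql (dist2_pseudometric d) _ (dist2_mix d a b)).
exists r'', (points G''); split=> // e.
  rewrite -GE => /(leaf_zigzag_aux fG sA cA sB cB)[e1 [e2 [e3 [e4 [[p1 p2 _ _] h1' h2' _ _]]]]].
  rewrite GE in p1 p2.
  by apply: recover h1' h2'; apply: J => //; exact: leaf_base lE'.
rewrite -GE' => /(leaf_zigzag_aux fG' sA' cA' sB' cB')[e1 [e2 [e3 [e4 [[_ _ p3 p4] _ _ h3 h4]]]]].
rewrite GE' in p3 p4.
by apply: recover h3 h4; apply: J => //; exact: leaf_base lE.
Qed.

(** A leaf containing both [E] and [E'] has at most the dimension of [E]. Both being Euclidean, the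
    inclusion of [E] is an isometric embedding that must be onto. *)
Lemma leaf_maximum n0 r0 E0 :
  (forall r (N : 'rV[R]_r -> R) G, framed_flat x N G -> (r <= n0)%N) ->
  leaf r0 E0 -> exists r E, leaf r E /\ forall r' E', leaf r' E' -> E' `<=` E.
Proof.
move=> bound l0.
pose P r := `[< exists E, leaf r E >].
have exP : exists r, P r by exists r0; apply/asboolP; exists E0.
have leP r : P r -> (r <= n0)%N.
  by move=> /asboolP[E [N [G [A [B [fG _ _ _]]]]]]; exact: bound fG.
case: (ex_maxnP exP leP) => r /asboolP[E lE] rmax.
exists r, E; split=> // r' E' lE'.
have [r'' [E'' [lE'' EE'' E'E'']]] := leaf_directed bound lE lE'.
have [m [phi [rE phi_iso phiE]]] := leaf_euclidean lE.
have [m'' [phi'' [rE'' phi_iso'' phiE'']]] := leaf_euclidean lE''.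
have mm : (2 * m'' <= 2 * m)%N.
  by rewrite -rE -rE''; apply: rmax; apply/asboolP; exists E''.
have /choice[f fP] (u : euclidean R (2 * m)) : exists v, phi'' v = phi u.
  have : E'' (phi u) by apply: EE''; rewrite -phiE; exists u.
  by rewrite -phiE'' => -[v _ <-]; exists v.
have f_iso : isometric_embedding f by move=> u v; rewrite -phi_iso'' !fP phi_iso.
apply: subset_trans E'E'' _; rewrite -phiE'' => _ [w _ <-].
have [u <-] := isometric_embedding_onto f_iso mm w.
by rewrite fP -phiE; exists u.
Qed.

End leaves.

(** * The given product decompositions, and the conclusion *)

Section l2prod_decomposition.
Context {R : realType} {X Y Y' : metricType R} (I : X -> l2prod Y Y').

Lemma l2prod_decomposition : is_isometry I ->
  exists d : decomposition X,
    (forall p q, dist1 d p q = mdist (I p).1 (I q).1) /\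
    (forall p q, dist2 d p q = mdist (I p).2 (I q).2).
Proof.
move=> [Iiso Ionto].
have /choice[mx mxP] (pq : X * X) : exists s, I s = ((I pq.1).1, (I pq.2).2) :> l2prod Y Y'.
  have : range I (((I pq.1).1, (I pq.2).2) : l2prod Y Y') by rewrite Ionto.
  by move=> [s _ sE]; exists s.
have pm (Z : metricType R) (f : X -> Z) : is_pseudometric (fun p q => mdist (f p) (f q)).
  split=> *; [exact: mdistxx|exact: metric_sym|exact: metric_triangle].
unshelve eexists (@Decomposition R X _ _ (fun p q => mx (p, q))
  (pm Y (fun p => (I p).1)) (pm Y' (fun p => (I p).2)) _ _ _).
- move=> p q; rewrite -Iiso mdist_l2prodE sqr_sqrtr//.
  by rewrite addr_ge0// sqr_ge0.
- by move=> p q; rewrite /= mxP mdistxx.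
- by move=> p q; rewrite /= mxP mdistxx.
- by [].
Qed.

End l2prod_decomposition.

Theorem corollary1p2 (R : realType) (X Y Y' Z Z' : metricType R)
    (I : X -> l2prod Y Y') (J : X -> l2prod Z Z') (x : X) :
  geodesic_space X ->
  (affine_rank X < +oo)%E ->
  is_isometry I ->
  is_isometry J ->
  transversal_at I J x ->
  exists m : nat, isometric X (euclidean R (2 * m)).
Proof.
move=> geo rk isoI isoJ [tr1 tr2 tr3 tr4].
have [d [d1 d2]] := l2prod_decomposition isoI.
have [d' [d1' d2']] := l2prod_decomposition isoJ.
have tr : transversal d d' x.
  move=> y; rewrite d1 d2 d1' d2'; split=> /mdist_positivity Ey /mdist_positivity Jy.
  - by have : [set x] y by rewrite -tr1; split; rewrite /fiber1 /snd_proj /=.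
  - by have : [set x] y by rewrite -tr2; split; rewrite /fiber1 /fiber2 /snd_proj /fst_proj /=.
  - by have : [set x] y by rewrite -tr3; split; rewrite /fiber1 /fiber2 /snd_proj /fst_proj /=.
  - by have : [set x] y by rewrite -tr4; split; rewrite /fiber2 /fst_proj /=.
have [n0 bound0] := affine_rank_bound rk.
have bound r (N : 'rV[R]_r -> R) G : framed_flat x N G -> (r <= n0)%N.
  by move=> fG; apply: (framed_dim_bound fG bound0).
have through y : exists r E, leaf d d' x r E /\ E y.
  have [a [b [g [ab g_geo ga gb]]]] := geo x y.
  (* The geodesic is reparametrized by [[0, 1]], so its length becomes the seminorm, which is zero
     when [y] is [x]. *)
  pose M (u : 'rV[R]_1) := (b - a) * `|u 0 0|.
  pose G : set ('rV[R]_1 * X) :=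
    [set z : 'rV[R]_1 * X | 0 <= z.1 0 0 <= 1 /\ z.2 = g (a + z.1 0 0 * (b - a))].
  have ba : 0 <= b - a by rewrite subr_ge0.
  have flG : flat x M G.
    split.
    - split=> [u v|t u]; rewrite /M !mxE; last by rewrite normrM; ring.
      by rewrite -mulrDr ler_wpM2l// ler_normD.
    - have ab_in t : 0 <= t <= 1 -> a + t * (b - a) \in `[a, b].
        by move=> /andP[t0 t1]; rewrite in_itv/=; apply/andP; split; nra.
      move=> u v p q [/= u01 pE] [/= v01 qE].
      rewrite pE qE g_geo ?ab_in// /M !mxE opprD addrACA subrr add0r -mulrBl.
      by rewrite normrM (ger0_norm ba) mulrC.
    - move=> u v p q t [/= /andP[u0 u1] _] [/= /andP[v0 v1] _] /andP[t0 t1].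
      exists (g (a + (u + t *: (v - u)) 0 0 * (b - a))); split=> //=.
      by rewrite !mxE; apply/andP; split; nra.
    - by split; rewrite /= mxE ?lexx ?ler01// mul0r addr0 ga.
  have [r [N [G1 [A [B [fG1 GG1 hA hB]]]]]] := saturated_flat d d' bound flG.
  exists r, (points G1); split; first by exists N, G1, A, B.
  apply: GG1; exists (const_mx 1, y) => //; split; rewrite /= mxE ?lexx ?ler01//.
  by rewrite mul1r addrC subrK gb.
have [r0 [E0 [l0 _]]] := through x.
have [r [E [lE Emax]]] := leaf_maximum tr bound l0.
have [m [phi [_ phi_iso phiE]]] := leaf_euclidean tr lE.
have /choice[f fP] (y : X) : exists u, phi u = y.
  have [r' [E' [lE' E'y]]] := through y.
  by have := Emax _ _ lE' _ E'y; rewrite -phiE => -[u _ <-]; exists u.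
exists m, f; split=> [y y'|]; first by rewrite -phi_iso !fP.
apply/seteqP; split=> // u _; exists (phi u) => //.
by apply: (@mdist_positivity R); rewrite -phi_iso fP mdistxx.
Qed.
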